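(* There are constants $A_{k,q}>0$, for integers $k\ge 2$ and real $1\le q<\infty$, depending only on $k$ and $q$ (in particular independent of $n$), such that the following holds. Let $k\ge 2$, let $n\in\mathbb N$ and let $\mathcal S$ be an $S_p(k-1,k,n)$ partial Steiner system. Then there exist signs $(c_J)_{J\in\mathcal S}$, $c_J\in\{-1,1\}$, such that the $k$-homogeneous polynomial $p(z)=\sum_{J\in\mathcal S}c_Jz_J$ in $n$ complex variables satisfies $$\|p\|_{\mathcal P(^k\ell_q^n)}\le A_{k,q}\times\begin{cases}\log^{\frac{3}{q}}(n)\; n^{\frac{k}{2}\left(\frac{q-2}{q}\right)} & \text{for } 2\le q<\infty,\\[2pt] \log^{\frac{3q-3}{q}}(n) & \text{for } 1\le q\le 2.\end{cases}$$ Moreover, for $q\ne 2$ the constant $A_{k,q}$ may be taken independent of $k$.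
   Context: An $S_p(t,k,n)$ partial Steiner system is a collection of subsets of size $k$ of $\{1,\dots,n\}$ such that every subset of $\{1,\dots,n\}$ with $t$ elements is contained in at most one member of the collection. For $J=\{j_1,\dots,j_k\}$ put $z_J=z_{j_1}\cdots z_{j_k}$. $\ell_q^n$ is $\mathbb C^n$ with the norm $\|z\|_q=(\sum_{i=1}^n|z_i|^q)^{1/q}$, and for a $k$-homogeneous polynomial $p$ on $\mathbb C^n$, $\|p\|_{\mathcal P(^k\ell_q^n)}=\sup\{|p(z)|:\|z\|_q\le 1\}$. *)

(* Defs.v *)
From HB Require Import structures.
From mathcomp Require Import all_boot all_order all_algebra.
From mathcomp Require Import all_classical all_reals all_analysis.
From mathcomp Require Export complex.

Set Implicit Arguments.
Unset Strict Implicit.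
Unset Printing Implicit Defensive.

Import Order.TTheory GRing.Theory Num.Theory.
Local Open Scope ring_scope.

(* The ground set {1, ..., n} is represented by 'I_n. *)
Definition partial_steiner (t k n : nat) (S : {set {set 'I_n}}) : Prop :=
  (forall J : {set 'I_n}, J \in S -> #|J| = k) /\
  (forall T : {set 'I_n}, #|T| = t -> (#|[set J in S | T \subset J]| <= 1)%N).

(* ||z||_q; the modulus [Normc.normc] is R-valued, whereas `|z| lives in R[i]. *)
Definition lq_norm (R : realType) (n : nat) (q : R) (z : 'rV[R[i]]_n) : R :=
  (\sum_(i < n) Normc.normc (z ord0 i) `^ q) `^ q^-1.

(* The supremum is taken in \bar R, so that bounding it by a real number
   also asserts that it is finite. *)
Definition sup_norm (R : realType) (n : nat) (q : R)
    (p : 'rV[R[i]]_n -> R[i]) : \bar R :=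
  ereal_sup [set (Normc.normc (p z))%:E | z in [set z | lq_norm q z <= 1]].

Definition set_monomial (R : realType) (n : nat) (J : {set 'I_n})
    (z : 'rV[R[i]]_n) : R[i] :=
  \prod_(j in J) z ord0 j.

Definition signed_poly (R : realType) (n : nat) (S : {set {set 'I_n}})
    (c : {set 'I_n} -> R[i]) (z : 'rV[R[i]]_n) : R[i] :=
  \sum_(J in S) c J * set_monomial J z.

(* Main.v *)
Require Import Defs.
From HB Require Import structures.
From mathcomp Require Import all_boot all_order all_algebra.
From mathcomp Require Import all_classical all_reals all_analysis.
From mathcomp Require Import complex.
From mathcomp Require Import ring lra zify.

Set Implicit Arguments.
Unset Strict Implicit.
Unset Printing Implicit Defensive.

Import Order.TTheory GRing.Theory Num.Theory.
Import numFieldNormedType.Exports.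
Local Open Scope ring_scope.

(** Only three exponents need a probabilistic or combinatorial argument; all
    the others follow by interpolation, with one choice of signs.  Write
    [p(z) = \sum_J c_J z_J].

    Interpolation.  For [|z|_q <= 1] let each coordinate [z_i] move along the
    holomorphic curve [s |-> (z_i/|z_i|) |z_i|^(a0 + s (a1 - a0))].  Composing
    [p] with this curve gives a finite exponential sum in [s], and on the two
    boundary lines of the strip [0 <= Re s <= 1] the curve stays in the unit
    balls with exponents [q/a0] and [q/a1] (infinite when [a1 = 0]).  Hadamard's
    three lines theorem ([three_lines]) therefore yields
    [|p|_q <= |p|_(q0)^(1-x) |p|_(q1)^x] ([poly_interpolation]): the polynomial
    itself interpolates, so no polarization constant depending on [k] enters.
    The powers of [log n] and [n] in the theorem are what this gives from the
    bounds [1] on the [l_1] ball, [A log^(3/2) n] on the [l_2] ball and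
    [B n^(k/2)] on the [l_oo] ball, with [A] and [B] absolute.  Absolute
    constants are what makes the final constant independent of [k].

    The [l_1] bound holds for all signs, since an elementary symmetric function
    of moduli with sum at most [1] is at most [1] ([block_sum_l1]).

    For the other two balls the signs are random.  The key point is that the
    subgaussian metric of the process [z |-> p(z)] is controlled by the sup
    norm: expanding [u_J - v_J] one coordinate at a time leaves squared moduli of
    products over [k-1] coordinates, and the Steiner property says that each
    set of [k-1] indices occurs at most once, so that the variance of
    [p(u) - p(v)] is at most [2 |u - v|_oo^2 s^(k-1)] when [|v_i| <= |u_i|] and
    [\sum_i |u_i|^2 <= s] ([steiner_increment_le]).  The factor
    [k] lost when the expansion is squared is absorbed by the factor [1/(k-1)]
    in the bound for the symmetric function of degree [k-1].

    Chaining: [z] is rounded towards zero to the grids [2^-j Z[i]].  Rounding at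
    level [j] is a function of rounding at level [j+1], so a link of the chain
    is named by a single lattice point ([lattice]).  A union bound over all
    links at all levels ([lattice_union_bound]) uses two counts.  There are
    [exp(O(n (j+1)))] lattice points in the polydisc, and a lattice point in
    the [l_2] ball is described by integers with sum of squares at most [4^j],
    which leaves only [exp(O(4^j log n))] of them.  On the [l_oo] ball
    the first count alone gives
    [\sum_j sqrt(n) (j+1) 2^-j n^((k-1)/2) = O(n^(k/2))].  On the [l_2] ball the
    second count is used for the [O(log n)] levels with [4^j <= n], each of
    which costs [O(sqrt(log n))], and the first count for the finer levels, which
    together cost [O(log n)]; the total is [O(log^(3/2) n)]
    ([exists_signs_l2_linf]). *)

Local Notation normc := Normc.normc.
Local Notation Re := (@complex.Re _).
Local Notation Im := (@complex.Im _).

(** * The modulus of a complex number *)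

Lemma normc_ge0 (R : realType) (z : R[i]) : 0 <= normc z.
Proof. by case: z => a b /=; exact: sqrtr_ge0. Qed.

Lemma normc_normE (R : realType) (z : R[i]) : `|z| = (real_complex R (normc z)).
Proof. by []. Qed.

Lemma sqr_normc (R : realType) (z : R[i]) :
  normc z ^+ 2 = Re z ^+ 2 + Im z ^+ 2.
Proof. by case: z => a b /=; rewrite sqr_sqrtr // addr_ge0 ?sqr_ge0. Qed.

Lemma normcD_le (R : realType) (z w : R[i]) : normc (z + w) <= normc z + normc w.
Proof.
have := ler_normD z w; rewrite !normc_normE -rmorphD /= lecR //.
Qed.

Lemma normc_sum_le (R : realType) (I : Type) (r : seq I) (P : pred I)
    (F : I -> R[i]) :
  normc (\sum_(i <- r | P i) F i) <= \sum_(i <- r | P i) normc (F i).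
Proof.
elim/big_ind2: _ => //; first by rewrite Normc.normc0.
by move=> x1 x2 y1 y2 h1 h2; apply: le_trans (normcD_le _ _) _; exact: lerD.
Qed.

Lemma normc_prod (R : realType) (I : Type) (r : seq I) (P : pred I)
    (F : I -> R[i]) :
  normc (\prod_(i <- r | P i) F i) = \prod_(i <- r | P i) normc (F i).
Proof.
by apply: (big_morph _ (@Normc.normcM R)); rewrite Normc.normc1.
Qed.

Lemma normcR (R : realType) (x : R) : normc (real_complex R x) = `|x|.
Proof. by rewrite /= expr0n addr0 sqrtr_sqr. Qed.

Lemma normcN (R : realType) (z : R[i]) : normc (- z) = normc z.
Proof. by case: z => a b /=; rewrite !sqrrN. Qed.

Lemma normc_le_sum (R : realType) (z : R[i]) : normc z <= `|Re z| + `|Im z|.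
Proof.
rewrite -(@ler_pXn2r _ 2) ?nnegrE ?normc_ge0 ?addr_ge0 //.
rewrite sqr_normc sqrrD -!normrX !(ger0_norm (sqr_ge0 _)).
by rewrite lerD2r lerDl mulrn_wge0 // mulr_ge0.
Qed.

Lemma Re_sum (R : realType) (I : Type) (r : seq I) (P : pred I) (F : I -> R[i]) :
  Re (\sum_(i <- r | P i) F i) = \sum_(i <- r | P i) Re (F i).
Proof. by elim/big_rec2: _ => // i y1 [a b] _ /= <-; case: (F i). Qed.

Lemma Im_sum (R : realType) (I : Type) (r : seq I) (P : pred I) (F : I -> R[i]) :
  Im (\sum_(i <- r | P i) F i) = \sum_(i <- r | P i) Im (F i).
Proof. by elim/big_rec2: _ => // i y1 [a b] _ /= <-; case: (F i). Qed.

(** * Random signs *)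

(** Weaker than [cosh x <= exp (x^2 / 2)], but a consequence of
    [1 + x <= exp x] alone; it makes a Rademacher sum subgaussian with an
    absolute constant. *)
Lemma expR_cosh_le (R : realType) (x : R) :
  expR x + expR (- x) <= 2 * expR (2 * x ^+ 2).
Proof.
have hab : expR x * expR (- x) = 1 by rewrite -expRD subrr expR0.
have ha : 0 < expR x := expR_gt0 x.
have hb : 0 < expR (- x) := expR_gt0 (- x).
have h1 := expR_ge1Dx x; have h2 := expR_ge1Dx (- x).
have h3 := expR_ge1Dx (2 * x ^+ 2).
(* For small [x] both exponentials are bounded by [exp x <= 1 / (1 - x)]; for
   large [x] both exponents are at most [2 x^2]. *)
case: (leP (2 * x ^+ 2) 1) => hx.
  have ax : expR x * (1 - x) <= 1 by rewrite -[leRHS]hab ler_pM2l.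
  have bx : expR (- x) * (1 + x) <= 1 by rewrite -[leRHS]hab [leRHS]mulrC ler_pM2l.
  move: (expR x) (expR (- x)) (expR (2 * x ^+ 2)) ha hb h3 ax bx.
  move=> a b e ha hb h3 ax bx.
  have k1 : (a + b) * (1 - x ^+ 2) <= 2.
    have x1 : 0 <= 1 - x by nra.
    have x2 : 0 <= 1 + x by nra.
    have := ler_wpM2r x2 ax; have := ler_wpM2r x1 bx; lra.
  have k2 : (a + b) * 1 <= (a + b) * ((1 - x ^+ 2) * (1 + 2 * x ^+ 2)).
    apply: ler_wpM2l; first lra.
    have := sqr_ge0 x; nra.
  have k3 : (a + b) * (1 - x ^+ 2) * (1 + 2 * x ^+ 2) <= 2 * (1 + 2 * x ^+ 2).
    by apply: ler_wpM2r => //; have := sqr_ge0 x; lra.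
  by rewrite mulr1 mulrA in k2; lra.
have h4 : expR x <= expR (2 * x ^+ 2) by rewrite ler_expR; nra.
have h5 : expR (- x) <= expR (2 * x ^+ 2) by rewrite ler_expR; nra.
lra.
Qed.

Lemma sum_signs_expR_le (R : realType) (T : finType) (D : T -> R) :
  \sum_(c : {ffun T -> bool}) expR (\sum_t (-1) ^+ c t * D t) <=
  #|{ffun T -> bool}|%:R * expR (2 * \sum_t D t ^+ 2).
Proof.
have -> : \sum_(c : {ffun T -> bool}) expR (\sum_t (-1) ^+ c t * D t) =
    \sum_(c : {ffun T -> bool}) \prod_t expR ((-1) ^+ c t * D t).
  by apply: eq_bigr => c _; rewrite expR_sum.
rewrite -(bigA_distr_bigA (fun t (b : bool) => expR ((-1) ^+ b * D t))) /=.
rewrite card_ffun card_bool natrX mulr_sumr expR_sum -prodr_const -big_split /=.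
apply: ler_prod => t _; apply/andP; split.
  by apply: sumr_ge0 => b _; exact: expR_ge0.
rewrite big_bool /= expr0 expr1 mul1r mulN1r addrC.
exact: expR_cosh_le.
Qed.

Lemma exists_le_mean (R : realType) (C : finType) (f : C -> R) (a : R) (c0 : C) :
  \sum_c f c <= #|C|%:R * a -> exists c, f c <= a.
Proof.
move=> h; have [//|/forallNP hn] := pselect (exists c, f c <= a).
have : #|C|%:R * a < \sum_c f c.
  have -> : #|C|%:R * a = \sum_(c : C) a by rewrite sumr_const mulr_natl.
  apply: ltr_sum; first by apply/hasP; exists c0; rewrite ?mem_index_enum.
  by move=> c _; rewrite ltNge; apply/negP/hn.
by rewrite ltNge h.
Qed.

(** A union bound in exponential-moment form.  Chernoff's bound at
    the scale [lam = 2 tau / (3 sigma)] turns each event into a term of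
    a sum with mean at most [\sum_i 2 exp (- tau_i^2) <= 1]; at a choice of signs
    where the sum does not exceed its mean, every single term is at most [1],
    which is the asserted inequality. *)
Lemma random_signs (R : realType) (T I : finType)
    (D : I -> T -> R) (tau sigma : I -> R) :
  (forall i, 0 < tau i) -> (forall i, 0 <= sigma i) ->
  (forall i, \sum_t D i t ^+ 2 <= sigma i ^+ 2) ->
  \sum_i 2 * expR (- tau i ^+ 2) <= 1 ->
  exists c : {ffun T -> bool}, forall i,
    `|\sum_t (-1) ^+ c t * D i t| <= 3 * tau i * sigma i.
Proof.
move=> tau0 sig0 hD hsum.
(* If [sigma i = 0] then [lam i = 0] as well and the term carries no
   information; that case is treated separately. *)
pose lam i := 2 / 3 * tau i / sigma i.
pose X i (c : {ffun T -> bool}) := \sum_t (-1) ^+ c t * D i t.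
pose w i := expR (- (2 * (lam i * sigma i) ^+ 2) - tau i ^+ 2).
pose f (c : {ffun T -> bool}) :=
  \sum_i (expR (lam i * X i c) + expR (- lam i * X i c)) * w i.
have meanX i (l : R) : l ^+ 2 = lam i ^+ 2 ->
    \sum_c expR (l * X i c) <=
    #|{ffun T -> bool}|%:R * expR (2 * (lam i * sigma i) ^+ 2).
  move=> hl; have -> : \sum_c expR (l * X i c) =
     \sum_(c : {ffun T -> bool}) expR (\sum_t (-1) ^+ c t * (l * D i t)).
    apply: eq_bigr => c _; rewrite /X mulr_sumr; congr expR.
    by apply: eq_bigr => t _; rewrite mulrCA.
  apply: le_trans (sum_signs_expR_le _) _.
  apply: ler_wpM2l; first by [].
  rewrite ler_expR ler_wpM2l // exprMn -hl.
  rewrite (eq_bigr (fun t => l ^+ 2 * D i t ^+ 2)); last by move=> t _; rewrite exprMn.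
  by rewrite -mulr_sumr ler_wpM2l ?sqr_ge0 ?hD.
have [|c hc] := @exists_le_mean _ _ f 1 [ffun=> true].
  rewrite /f exchange_big /= mulr1.
  have -> : #|{ffun T -> bool}|%:R = #|{ffun T -> bool}|%:R * 1 :> R by rewrite mulr1.
  apply: le_trans (ler_wpM2l _ hsum); last by [].
  rewrite mulr_sumr; apply: ler_sum => i _.
  rewrite -mulr_suml big_split /=.
  have -> : expR (- tau i ^+ 2) = expR (2 * (lam i * sigma i) ^+ 2) * w i.
    by rewrite /w -expRD; congr expR; ring.
  rewrite (mulrA 2) mulrA; apply: ler_wpM2r; first exact: expR_ge0.
  apply: le_trans (lerD (meanX i _ erefl) (meanX i _ (sqrrN _))) _.
  by set E := expR (2 * _); rewrite mulrA [leRHS]mulrAC [leRHS]mulr_natr mulr2n.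
exists c => i.
have [s0|s0] := eqVneq (sigma i) 0.
  have D0 t : D i t = 0.
    apply/eqP; rewrite -sqrf_eq0 eq_le sqr_ge0 andbT.
    apply: le_trans (le_trans _ (hD i)) _; last by rewrite s0 expr0n.
    by rewrite (bigD1 t) //= lerDl sumr_ge0 // => j _; exact: sqr_ge0.
  rewrite big1 ?normr0 ?s0 ?mulr0 // => t _; by rewrite D0 mulr0.
have sp : 0 < sigma i by rewrite lt_neqAle eq_sym s0 sig0.
have tp := tau0 i.
have lp : 0 < lam i by rewrite /lam divr_gt0 // mulr_gt0 // divr_gt0.
have hi : (expR (lam i * X i c) + expR (- lam i * X i c)) * w i <= 1.
  apply: le_trans hc; rewrite /f (bigD1 i) //= lerDl sumr_ge0 // => j _.
  by rewrite mulr_ge0 ?expR_ge0 // addr_ge0 // expR_ge0.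
have hi2 (l : R) : (l = lam i \/ l = - lam i) ->
    l * X i c <= 2 * (lam i * sigma i) ^+ 2 + tau i ^+ 2.
  move=> hl; rewrite -subr_le0 opprD addrA -expR_le1.
  rewrite -addrA expRD; apply: le_trans hi; rewrite ler_wpM2r ?expR_ge0 //.
  by case: hl => ->; rewrite ?lerDl ?lerDr expR_ge0.
have hls : lam i * sigma i = 2 / 3 * tau i by rewrite /lam; field; exact: s0.
have key : lam i * `|X i c| <= lam i * (3 * tau i * sigma i).
  have -> : lam i * (3 * tau i * sigma i) = 3 * tau i * (lam i * sigma i) by ring.
  have h1 := hi2 _ (or_introl erefl); have h2 := hi2 _ (or_intror erefl).
  rewrite hls in h1 h2 *.
  have := sqr_ge0 (tau i); move: h1 h2.
  have [x0|x0] := leP 0 (X i c); [rewrite ger0_norm // | rewrite ltr0_norm //];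
    rewrite ?mulrN ?mulNr; move: (lam i * X i c) (tau i) => a b; lra.
by rewrite ler_pM2l in key.
Qed.

(** The real and imaginary parts are separate constraints,
    whence the constants [4 = 2 * 2] and [6 = 2 * 3]. *)
Lemma random_signs_complex (R : realType) (T I : finType)
    (D : I -> T -> R[i]) (tau sigma : I -> R) :
  (forall i, 0 < tau i) -> (forall i, 0 <= sigma i) ->
  (forall i, \sum_t normc (D i t) ^+ 2 <= sigma i ^+ 2) ->
  \sum_i 4 * expR (- tau i ^+ 2) <= 1 ->
  exists c : {ffun T -> bool}, forall i,
    normc (\sum_t (-1) ^+ c t * D i t) <= 6 * tau i * sigma i.
Proof.
move=> tau0 sig0 hD hsum.
have [|||| c hc] := @random_signs R T (I * bool)%type
  (fun ib t => if ib.2 then Re (D ib.1 t) else Im (D ib.1 t))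
  (fun ib => tau ib.1) (fun ib => sigma ib.1).
- by move=> ib.
- by move=> ib.
- move=> [i b] /=; apply: le_trans (hD i); apply: ler_sum => t _.
  by rewrite sqr_normc; case: b; rewrite ?lerDl ?lerDr sqr_ge0.
- rewrite -(pair_bigA _ (fun i (b : bool) => 2 * expR (- tau i ^+ 2))) /=.
  apply: le_trans hsum; apply: ler_sum => i _; rewrite big_bool /=; lra.
exists c => i; apply: le_trans (normc_le_sum _) _.
have hs (b : bool) t : ((-1) ^+ b * D i t : R[i]) =
   Complex ((-1) ^+ b * Re (D i t)) ((-1) ^+ b * Im (D i t)).
  by case: b; case: (D i t) => x y; rewrite ?(expr1, expr0, mul1r, mulN1r).
have hRe : Re (\sum_t (-1) ^+ c t * D i t) = \sum_t (-1) ^+ c t * Re (D i t).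
  by rewrite Re_sum; apply: eq_bigr => t _; rewrite hs.
have hIm : Im (\sum_t (-1) ^+ c t * D i t) = \sum_t (-1) ^+ c t * Im (D i t).
  by rewrite Im_sum; apply: eq_bigr => t _; rewrite hs.
have := hc (i, true); have := hc (i, false); rewrite hRe hIm /=; lra.
Qed.

(** * Increments of the monomials of a partial Steiner system *)

Definition elem_sym (R : realType) (n m : nat) (x : 'I_n -> R) : R :=
  \sum_(I : {set 'I_n} | #|I| == m) \prod_(i in I) x i.

(** Double counting of pairs: [(J, j)] with [j \in J] against
    [(I, j)] with [j \notin I], through [I = J :\ j]. *)
Lemma sum_setD1 (R : realType) (n m : nat) (F : {set 'I_n} -> 'I_n -> R) :
  \sum_(J : {set 'I_n} | #|J| == m.+1) \sum_(j in J) F (J :\ j) j =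
  \sum_(I : {set 'I_n} | #|I| == m) \sum_(j in ~: I) F I j.
Proof.
rewrite (exchange_big_dep xpredT) //= [RHS](exchange_big_dep xpredT) //=.
apply: eq_bigr => j _.
rewrite (reindex_onto (fun I => j |: I) (fun J => J :\ j)) /=; last first.
  by move=> J /andP[_ jJ]; rewrite finset.setD1K.
apply: eq_big => [I|I /andP[/andP[_ _] /eqP ->] //].
rewrite finset.in_setC setU11 andbT cardsU1.
have [jI|jI] /= := boolP (j \in I).
  rewrite andbF; apply/negP => /andP[_ /eqP h].
  by have := jI; rewrite -h !inE eqxx.
by rewrite andbT setU1K // eqxx andbT add1n eqSS.
Qed.

(** The double counting identity [(m+1) e_(m+1) =
    \sum_I x_I \sum_(j \notin I) x_j], in which the inner sum is at most [s]. *)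
Lemma elem_symS_le (R : realType) (n m : nat) (x : 'I_n -> R) (s : R) :
  (forall i, 0 <= x i) -> \sum_i x i <= s ->
  m.+1%:R * elem_sym m.+1 x <= s * elem_sym m x.
Proof.
move=> x0 hs; rewrite /elem_sym mulr_sumr.
rewrite (eq_bigr (fun J : {set 'I_n} =>
    \sum_(j in J) ((\prod_(i in J :\ j) x i) * x j))); last first.
  move=> J /eqP hJ; rewrite -hJ -sum1_card natr_sum mulr_suml.
  by apply: eq_bigr => j jJ; rewrite mul1r (big_setD1 j) //= mulrC.
rewrite (sum_setD1 m (fun I j => (\prod_(i in I) x i) * x j)).
rewrite mulr_sumr; apply: ler_sum => I _.
rewrite -mulr_sumr mulrC ler_wpM2r ?prodr_ge0 //.
apply: le_trans hs; rewrite [leRHS](bigID (mem (~: I))) /= lerDl.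
by apply: sumr_ge0.
Qed.

Lemma elem_sym_ge0 (R : realType) (n m : nat) (x : 'I_n -> R) :
  (forall i, 0 <= x i) -> 0 <= elem_sym m x.
Proof. by move=> x0; apply: sumr_ge0 => I _; exact: prodr_ge0. Qed.

(** The factor [m+1] is all that is kept of the true [(m+1)!]: it is
    enough to compensate the loss of Cauchy-Schwarz in
    [steiner_increment_le]. *)
Lemma elem_sym_le (R : realType) (n m : nat) (x : 'I_n -> R) (s : R) :
  (forall i, 0 <= x i) -> \sum_i x i <= s ->
  m.+1%:R * elem_sym m.+1 x <= s ^+ m.+1.
Proof.
move=> x0 hs; have s0 : 0 <= s by apply: le_trans hs; exact: sumr_ge0.
elim: m => [|m IH].
  rewrite (le_trans (elem_symS_le 0 x0 hs)) // expr1 -[leRHS]mulr1 ler_wpM2l //.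
  rewrite /elem_sym (big_pred1 finset.set0) ?big_set0 // => I /=.
  by rewrite cards_eq0.
rewrite (le_trans (elem_symS_le m.+1 x0 hs)) // exprS ler_wpM2l //.
apply: le_trans IH; rewrite ler_peMl ?elem_sym_ge0 // ler1n //.
Qed.

(** The packing condition says exactly that a set [I] of [k] indices
    arises as [J :\ j] from at most one block [J]. *)
Lemma steiner_sum_le (R : realType) (n k : nat) (S : {set {set 'I_n}})
    (x : 'I_n -> R) :
  partial_steiner k k.+1 S -> (forall i, 0 <= x i) ->
  \sum_(J in S) \sum_(j in J) \prod_(i in J :\ j) x i <= elem_sym k x.
Proof.
move=> [hk ht] x0.
pose g (I : {set 'I_n}) := \prod_(i in I) x i.
have g0 I : 0 <= g I by exact: prodr_ge0.
have -> : \sum_(J in S) \sum_(j in J) \prod_(i in J :\ j) x i =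
   \sum_(J in S) \sum_(I : {set 'I_n} | (#|I| == k) && (I \subset J)) g I.
  apply: eq_bigr => J JS; rewrite -[LHS]/(\sum_(j in J) g (J :\ j)).
  rewrite -(big_imset g) /=; last first.
    move=> a b aJ bJ hab; apply/eqP; rewrite -[_ == _]negbK; apply/negP => nab.
    have : a \in J :\ b by rewrite !inE nab.
    by rewrite -hab !inE eqxx.
  apply: eq_bigl => I; apply/imsetP/andP => [[j jJ ->]|[/eqP cI sI]].
    rewrite subD1set; split=> //.
    by have := cardsD1 j J; rewrite jJ hk // add1n => -[<-].
  have : #|J :\: I| = 1%N by rewrite cardsD (finset.setIidPr sI) hk // cI subSnn.
  move=> /eqP/cards1P [j hj]; have jJI : j \in J :\: I by rewrite hj set11.
  exists j; first by move: jJI; rewrite inE => /andP[].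
  by rewrite -hj finset.setDDr finset.setDv finset.set0U (finset.setIidPr sI).
rewrite (exchange_big_dep (fun I : {set 'I_n} => #|I| == k)) /=; last first.
  by move=> J I _ /andP[].
apply: ler_sum => I /eqP cI.
rewrite sumr_const -mulr_natl -[leRHS]mul1r ler_wpM2r // lern1.
apply: leq_trans (ht I cI); apply: subset_leq_card; apply/fintype.subsetP => J.
by rewrite !inE -topredE /= => /andP[-> /andP[_ ->]].
Qed.

(** Telescoping: the factors [u i] are replaced by [v i] one at a time.
    The common majorant [x] keeps the bound symmetric in the order of the
    replacements. *)
Lemma normc_prodB_le (R : realType) (n : nat) (J : {set 'I_n})
    (u v : 'I_n -> R[i]) (x : 'I_n -> R) (eta : R) :
  (forall i, normc (u i) <= x i) -> (forall i, normc (v i) <= x i) ->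
  (forall i, normc (u i - v i) <= eta) ->
  normc (\prod_(i in J) u i - \prod_(i in J) v i) <=
  eta * \sum_(j in J) \prod_(i in J :\ j) x i.
Proof.
move=> hu hv he.
have x0 i : 0 <= x i by apply: le_trans (hu i); exact: normc_ge0.
elim: {J}#|J| {-2}J (erefl #|J|) => [|m IH] J0 /eqP.
  by rewrite cards_eq0 => /eqP ->; rewrite !big_set0 subrr Normc.normc0 mulr0.
case: (set_0Vmem J0) => [->|[j jJ0] cJ]; first by rewrite cards0.
have [jJ cJ0] : j \notin J0 :\ j /\ #|J0 :\ j| = m.
  by move: cJ; rewrite (cardsD1 j) jJ0 !inE eqxx => /eqP [].
rewrite -(finset.setD1K jJ0); move: (J0 :\ j) jJ (IH _ cJ0) => J jJ {}IH.
have e0 : 0 <= eta by apply: le_trans (he j); exact: normc_ge0.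
rewrite [X in normc (X - _)]big_setU1 // [X in normc (_ - X)]big_setU1 //.
rewrite [X in _ * X]big_setU1 // setU1K // mulrDr.
have -> : u j * \prod_(i in J) u i - v j * \prod_(i in J) v i =
  (u j - v j) * \prod_(i in J) u i +
  v j * (\prod_(i in J) u i - \prod_(i in J) v i) by ring.
apply: le_trans (normcD_le _ _) _; rewrite !Normc.normcM; apply: lerD.
  rewrite ler_pM ?normc_ge0 // normc_prod; apply: ler_prod => i _.
  by rewrite normc_ge0 hu.
apply: le_trans (ler_pM (normc_ge0 _) (normc_ge0 _) (hv j) IH) _.
rewrite mulrCA ler_wpM2l // mulr_sumr; apply: ler_sum => l lJ.
have lj : l != j by apply: contraNneq jJ => <-.
rewrite [leRHS](big_setD1 j) /=; last by rewrite !inE eq_sym lj eqxx.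
rewrite le_eqVlt; apply/orP; left; apply/eqP; congr (_ * _).
apply: eq_bigl => i; rewrite !inE.
case: (eqVneq i j) => [->|] //=; by rewrite (negbTE jJ) andbF.
Qed.

Lemma sqr_sum_le (R : realType) (I : finType) (A : {set I}) (f : I -> R) :
  (\sum_(i in A) f i) ^+ 2 <= #|A|%:R * \sum_(i in A) f i ^+ 2.
Proof.
rewrite expr2 mulr_suml -sum1_card natr_sum mulr_suml.
have -> : \sum_(i in A) f i * \sum_(j in A) f j =
    2^-1 * \sum_(i in A) \sum_(j in A) (f i * f j *+ 2).
  rewrite mulr_sumr; apply: eq_bigr => i _.
  by rewrite !mulr_sumr; apply: eq_bigr => j _; field.
have -> : \sum_(i in A) 1 * \sum_(i0 in A) f i0 ^+ 2 =
    2^-1 * \sum_(i in A) \sum_(j in A) (f i ^+ 2 + f j ^+ 2).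
  under [in RHS]eq_bigr do rewrite big_split /=.
  rewrite big_split /= [X in _ = _ * (X + _)]exchange_big /=.
  under eq_bigr do rewrite mul1r.
  by field.
rewrite ler_pM2l ?invr_gt0 //; apply: ler_sum => i _; apply: ler_sum => j _.
by rewrite -subr_ge0 (_ : _ - _ = (f i - f j) ^+ 2) ?sqr_ge0 //; ring.
Qed.

(** The variance of an increment of the random polynomial.
    Cauchy-Schwarz over the [k+1] terms of the telescoping costs a factor
    [k+1], while [steiner_sum_le] and [elem_sym_le] gain a factor [k]; their
    quotient is at most [2] for every [k]. *)
Lemma steiner_increment_le (R : realType) (n k : nat) (S : {set {set 'I_n}})
    (u v : 'I_n -> R[i]) (eta s : R) : (0 < k)%N ->
  partial_steiner k k.+1 S ->
  (forall i, normc (v i) <= normc (u i)) ->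
  (forall i, normc (u i - v i) <= eta) ->
  \sum_i normc (u i) ^+ 2 <= s ->
  \sum_(J in S) normc (\prod_(i in J) u i - \prod_(i in J) v i) ^+ 2 <=
  2 * eta ^+ 2 * s ^+ k.
Proof.
move=> k0 hS hv he hs.
pose x i := normc (u i) ^+ 2.
have x0 i : 0 <= x i by exact: sqr_ge0.
have h1 : \sum_(J in S) normc (\prod_(i in J) u i - \prod_(i in J) v i) ^+ 2 <=
    eta ^+ 2 * k.+1%:R * \sum_(J in S) \sum_(j in J) \prod_(i in J :\ j) x i.
  rewrite mulr_sumr; apply: ler_sum => J JS.
  have := @normc_prodB_le _ _ J u v (fun i => normc (u i)) eta _ hv he.
  move=> /(_ (fun i => lexx _)) h.
  rewrite (le_trans (lerXn2r 2 _ _ h)) ?nnegrE ?normc_ge0 //.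
    by apply: le_trans h; exact: normc_ge0.
  rewrite exprMn -mulrA ler_wpM2l ?sqr_ge0 //.
  rewrite (le_trans (sqr_sum_le _ _)) // hS.1 //.
  by under eq_bigr do rewrite -prodrXl.
apply: le_trans h1 _; have -> : 2 * eta ^+ 2 * s ^+ k = eta ^+ 2 * (2 * s ^+ k) by ring.
rewrite -[leLHS]mulrA ler_wpM2l ?sqr_ge0 //.
apply: (@le_trans _ _ (2 * (k%:R * elem_sym k x))).
  rewrite mulrA ler_pM ?ler0n ?sumr_ge0 //.
  - by move=> J _; apply: sumr_ge0 => j _; exact: prodr_ge0.
  - by rewrite -natrM ler_nat; lia.
  - exact: steiner_sum_le.
rewrite ler_wpM2l //; case: k k0 {hS} => // k _; exact: elem_sym_le.
Qed.

(** * Dyadic rounding of real numbers *)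

(** The real number of sign [s] and absolute value [m / 2^j].  Sign and
    magnitude are kept apart so that halving [m] rounds towards zero. *)
Definition dyad (R : realType) (j : nat) (s : bool) (m : nat) : R :=
  (-1) ^+ s * m%:R / 2 ^+ j.

Definition trunc_level (R : realType) (j : nat) (x : R) : nat :=
  Num.truncn (`|x| * 2 ^+ j).

(** Rounding goes towards zero, hence never increases a modulus: all
    points of a chain stay in the ball of the point that they approximate. *)
Definition round_dyad (R : realType) (j : nat) (x : R) : R :=
  dyad R j (x < 0) (trunc_level j x).

(** Coarser roundings are functions of finer ones. *)
Lemma trunc_level_half (R : realType) (j : nat) (x : R) :
  (trunc_level j.+1 x)./2 = trunc_level j x.
Proof.
have h0 : 0 <= `|x| * 2 ^+ j by rewrite mulr_ge0 // exprn_ge0.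
rewrite /trunc_level exprSr mulrA.
move: (`|x| * 2 ^+ j) h0 => y y0; apply/esym/truncn_def.
have y20 : 0 <= y * 2 by lra.
have /andP[h1 h2] := truncn_itv y20.
have := odd_double_half (Num.truncn (y * 2)); set m := Num.truncn _ in h1 h2 *.
move=> hm; have hm1 : (m./2 * 2 <= m)%N by lia.
have hm2 : (m.+1 <= m./2.+1 * 2)%N by lia.
rewrite -(ler_nat R) natrM in hm1; rewrite -(ler_nat R) natrM in hm2.
apply/andP; split; lra.
Qed.

Lemma trunc_level_le (R : realType) (j : nat) (x : R) :
  `|x| <= 1 -> (trunc_level j x <= 2 ^ j)%N.
Proof.
move=> x1; rewrite /trunc_level.
have h0 : 0 <= `|x| * 2 ^+ j by rewrite mulr_ge0 // exprn_ge0.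
have /andP[h1 _] := truncn_itv h0.
rewrite -(ler_nat R); apply: le_trans h1 _.
by rewrite natrX ler_piMl // exprn_ge0.
Qed.

Lemma norm_dyad (R : realType) (j : nat) (s : bool) (m : nat) :
  `|dyad R j s m| = m%:R / 2 ^+ j.
Proof.
by rewrite /dyad -mulrA normrMsign ger0_norm // divr_ge0 // exprn_ge0.
Qed.

Lemma norm_dyadB_half (R : realType) (j : nat) (s : bool) (m : nat) :
  `|dyad R j s m - dyad R j s (m./2).*2| <= 2 ^- j.
Proof.
rewrite /dyad -!mulrA -mulrBr -mulrBl normrMsign normrM.
rewrite [X in _ * X]ger0_norm ?invr_ge0 ?exprn_ge0 //.
rewrite ler_piMl ?invr_ge0 ?exprn_ge0 //.
have := odd_double_half m => /(congr1 (GRing.natmul (1 : R))).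
rewrite natrD => <-; rewrite addrK ger0_norm //.
by rewrite lern1; case: odd.
Qed.

Lemma norm_dyad_half_le (R : realType) (j : nat) (s : bool) (m : nat) :
  `|dyad R j s (m./2).*2| <= `|dyad R j s m|.
Proof.
rewrite !norm_dyad ler_wpM2r ?invr_ge0 ?exprn_ge0 // ler_nat.
by have := odd_double_half m; lia.
Qed.

Lemma dyadS (R : realType) (j : nat) (s : bool) (m : nat) :
  dyad R j.+1 s m.*2 = dyad R j s m.
Proof.
rewrite /dyad -mul2n natrM exprS; field.
by rewrite expf_eq0 /= pnatr_eq0 andbF.
Qed.

Lemma norm_round_le (R : realType) (j : nat) (x : R) :
  `|round_dyad j x| <= `|x|.
Proof.
have h0 : 0 <= `|x| * 2 ^+ j by rewrite mulr_ge0 // exprn_ge0.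
have /andP[h1 _] := truncn_itv h0.
by rewrite norm_dyad ler_pdivrMr ?exprn_gt0.
Qed.

Lemma norm_subr_round (R : realType) (j : nat) (x : R) :
  `|x - round_dyad j x| <= 2 ^- j.
Proof.
have h0 : 0 <= `|x| * 2 ^+ j by rewrite mulr_ge0 // exprn_ge0.
have /andP[h1 h2] := truncn_itv h0.
have p0 : 0 < 2 ^+ j :> R by rewrite exprn_gt0.
rewrite /round_dyad /dyad {1}(numEsign x) -mulrA -mulrBr normrMsign.
rewrite ger0_norm; last by rewrite subr_ge0 ler_pdivrMr.
rewrite lerBlDr -[X in X + _]mul1r -mulrDl ler_pdivlMr // addrC natr1 ltW //.
Qed.

(** * The union bound over lattice points *)

(** A lattice point of level [j] has [2n] real coordinates: the real part of
    the [i]-th entry is stored at [(i, false)], its imaginary part at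
    [(i, true)], each as a sign and a multiple of [2^-j] in [0, 1]. *)
Definition lattice (n j : nat) := {ffun 'I_n * bool -> bool * 'I_(2 ^ j).+1}.

(** The squared Euclidean norm, in units of [4^-j]. *)
Definition height (n j : nat) (m : lattice n j) : nat :=
  (\sum_ib (m ib).2 ^ 2)%N.

(** The lattice points of the [l_2] ball.  A zero coordinate must carry the
    positive sign: otherwise the [2^(2n)] sign patterns of the many vanishing
    coordinates would spoil the count. *)
Definition sparse (n j : nat) (m : lattice n j) : bool :=
  [forall ib, ((m ib).2 == 0%N :> nat) ==> ~~ (m ib).1] && (height m <= 4 ^ j)%N.

(** Dominates the square root of the logarithm of the number of lattice
    points of level [j], which is [O(sqrt(n (j + 1)))]; growth linear in [j] is
    harmless against [2^-j]. *)
Definition threshold_dense (R : realType) (n j : nat) : R :=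
  4 * Num.sqrt n%:R * j.+1%:R.

(** Dominates the square root of the logarithm of the number of sparse
    lattice points of level [j]. *)
Definition threshold_sparse (R : realType) (n j : nat) : R :=
  5 * 2 ^+ j * Num.sqrt (ln n%:R).

Definition threshold (R : realType) (n j : nat) (m : lattice n j) : R :=
  if sparse m then Num.min (threshold_dense R n j) (threshold_sparse R n j)
  else threshold_dense R n j.

Lemma expR1_ge2 (R : realType) : 2 <= expR 1 :> R.
Proof. by have := expR_ge1Dx (1 : R); lra. Qed.

Lemma expRN_nat_le (R : realType) (m : nat) : expR (- m%:R) <= 2 ^- m :> R.
Proof.
rewrite expRN lef_pV2 ?posrE ?expR_gt0 ?exprn_gt0 //.
by rewrite -[m%:R]mulr1 expRM_natl lerXn2r ?nnegrE ?expR_ge0 // expR1_ge2.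
Qed.

Lemma ln_nat_ge (R : realType) (n : nat) : (2 <= n)%N -> 2^-1 <= ln n%:R :> R.
Proof.
move=> n2; have h : 2^-1 <= ln 2 :> R.
  have := @le_ln1Dx R (- 2^-1); rewrite (_ : 1 - 2^-1 = 2^-1); last by field.
  rewrite lnV ?posrE // => h; have /h : -1 < - 2^-1 :> R by lra.
  lra.
by apply: le_trans h _; rewrite ler_ln ?posrE ?ltr0n ?ler_nat //; lia.
Qed.

Lemma geom_sum_le (R : realType) (q : R) (N : nat) : 0 <= q <= 2^-1 ->
  \sum_(i < N) q ^+ i <= 2.
Proof.
move=> /andP[q0 q1]; suff : \sum_(i < N) q ^+ i + 2 * q ^+ N <= 2.
  by have := exprn_ge0 N q0; lra.
elim: N => [|N IH]; first by rewrite big_ord0 expr0; lra.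
rewrite big_ord_recr /= exprS; have := exprn_ge0 N q0; nra.
Qed.

(** Each of the [2n] coordinates takes [2 (2^j + 1) <= 4^(j+1)]
    values. *)
Lemma dense_weight_le (R : realType) (n j : nat) : (0 < n)%N ->
  \sum_(m : lattice n j) expR (- threshold_dense R n j ^+ 2) <= 2 ^- (5 * j.+1).
Proof.
move=> n0; rewrite sumr_const /lattice card_ffun !card_prod card_bool !card_ord.
have -> : threshold_dense R n j ^+ 2 = (16 * n * j.+1 ^ 2)%:R.
  by rewrite /threshold_dense !exprMn sqr_sqrtr // !natrM ?natrX; ring.
rewrite -[leLHS]mulr_natl.
have hc : ((2 * (2 ^ j).+1) ^ (n * 2))%:R <= expR ((4 * n * j.+1)%:R) :> R.
  apply: (@le_trans _ _ ((2 ^ (4 * n * j.+1))%:R)).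
    rewrite ler_nat (_ : 4 * n * j.+1 = (2 * j.+1) * (n * 2))%N; last by lia.
    rewrite (expnM 2) leq_exp2r; last by lia.
    have h : (0 < 2 ^ j)%N by rewrite expn_gt0.
    have -> : (2 ^ (2 * j.+1) = 4 * (2 ^ j * 2 ^ j))%N.
      by rewrite mulnS expnD mul2n -addnn expnD.
    nia.
  rewrite -[X in expR X]mulr1 expRM_natl natrX.
  by rewrite lerXn2r ?nnegrE ?expR_ge0 // expR1_ge2.
apply: le_trans (ler_wpM2r (expR_ge0 _) hc) _.
rewrite -expRD; apply: le_trans (expRN_nat_le _ _); rewrite ler_expR.
have : (5 * j.+1)%:R + (4 * n * j.+1)%:R <= (16 * n * j.+1 ^ 2)%:R :> R.
  by rewrite -natrD ler_nat; nia.
lra.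
Qed.

(** The generating function of one coordinate with the weight
    [n^(-8 a^2)] of a magnitude [a]: the value zero contributes [1], and all the
    others only [O(n^-8)], so that even its [2n]-th power stays bounded. *)
Lemma one_coord_weight_le (R : realType) (n j : nat) : (2 <= n)%N ->
  \sum_(sa : bool * 'I_(2 ^ j).+1)
     (if (sa.2 == 0%N :> nat) && sa.1 then 0
      else expR (- (8 * ln n%:R * (sa.2 ^ 2)%:R))) <= 1 + 4 * n%:R ^- 8 :> R.
Proof.
move=> n2.
have n0 : 0 < n%:R :> R by rewrite ltr0n; lia.
pose q : R := n%:R ^- 8.
have q0 : 0 <= q by rewrite invr_ge0 exprn_ge0 // ltW.
have q1 : q <= 2^-1.
  rewrite lef_pV2 ?posrE ?exprn_gt0 // -natrX ler_nat.
  by apply: leq_trans (leq_pexp2l _ (_ : 1 <= 8)%N) => //; lia.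
have qb : q = expR (- (8 * ln n%:R)).
  by rewrite /q expRN (mulr_natl _ 8) -lnXn // lnK ?posrE ?exprn_gt0.
have tail : \sum_(i < 2 ^ j) expR (- (8 * ln n%:R * (i.+1 ^ 2)%:R)) <= 2 * q.
  apply: (@le_trans _ _ (\sum_(i < 2 ^ j) q * q ^+ i)).
    apply: ler_sum => i _; rewrite -exprS qb -expRM_natr ler_expR mulNr lerN2.
    rewrite ler_wpM2l ?ler_nat //; last by nia.
    by rewrite mulr_ge0 // ln_ge0 // ler1n; lia.
  by rewrite -mulr_sumr mulrC ler_wpM2r // geom_sum_le // q0 q1.
rewrite -(pair_bigA _ (fun (s : bool) (a : 'I_(2 ^ j).+1) =>
   if (a == 0%N :> nat) && s then 0 else expR (- (8 * ln n%:R * (a ^ 2)%:R)))) /=.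
rewrite big_bool /= !big_ord_recl /= !mulr0 oppr0 expR0 add0r.
have -> : \sum_(i < 2 ^ j) (if (lift ord0 i == 0%N :> nat) && true then 0
    else expR (- (8 * ln n%:R * (lift ord0 i ^ 2)%:R))) =
    \sum_(i < 2 ^ j) expR (- (8 * ln n%:R * (i.+1 ^ 2)%:R)) :> R.
  by apply: eq_bigr => i _.
rewrite -[X in X + (1 + _)]/(\sum_(i < 2 ^ j) expR (- (8 * ln n%:R * (i.+1 ^ 2)%:R))).
rewrite -[X in _ + (1 + X)]/(\sum_(i < 2 ^ j) expR (- (8 * ln n%:R * (i.+1 ^ 2)%:R))).
rewrite -/q; lra.
Qed.

(** On sparse points the height is at most [4^j], so a part of the
    factor [exp (- threshold^2)] can be traded for the weight
    [n^(-8 height)], which is a product over coordinates.  Summing it over all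
    lattice points factorizes into [one_coord_weight_le]. *)
Lemma sparse_weight_le (R : realType) (n j : nat) : (2 <= n)%N ->
  \sum_(m : lattice n j | sparse m) expR (- threshold_sparse R n j ^+ 2) <=
  2 ^- (5 * j.+1).
Proof.
move=> n2; pose b : R := ln n%:R.
have b2 : 2^-1 <= b by exact: ln_nat_ge.
have n0 : 0 < n%:R :> R by rewrite ltr0n; lia.
pose g (sa : bool * 'I_(2 ^ j).+1) : R := if (sa.2 == 0%N :> nat) && sa.1 then 0
      else expR (- (8 * b * (sa.2 ^ 2)%:R)).
have g0 sa : 0 <= g sa by rewrite /g; case: ifP => // _; exact: expR_ge0.
have thresholdE : threshold_sparse R n j ^+ 2 = 25 * (4 ^ j)%:R * b.
  rewrite /threshold_sparse !exprMn sqr_sqrtr; last by apply: le_trans b2.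
  have e4 : (4 ^ j)%:R = (2 ^+ j) ^+ 2 :> R.
    by rewrite exprAC natrX; congr (_ ^+ j); rewrite -natrX.
  by rewrite e4 -/b; ring.
have h1 : \sum_(m : lattice n j | sparse m) expR (- threshold_sparse R n j ^+ 2) <=
   \sum_(m : lattice n j) expR (- (17 * (4 ^ j)%:R * b)) * \prod_ib g (m ib).
  rewrite big_mkcond /=; apply: ler_sum => m _; case: ifP => [|_]; last first.
    by rewrite mulr_ge0 ?expR_ge0 // prodr_ge0.
  move=> /andP[/forallP hs hh].
  have -> : \prod_ib g (m ib) = expR (- (8 * b * (height m)%:R)).
    rewrite /height natr_sum mulr_sumr -sumrN expR_sum; apply: eq_bigr => ib _.
    rewrite /g; have := hs ib; case: (_ == _ :> nat) => //= /negbTE -> //.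
  rewrite -expRD ler_expR thresholdE -opprD lerN2.
  rewrite -(ler_nat R) in hh.
  have : b * (height m)%:R <= b * (4 ^ j)%:R by rewrite ler_wpM2l //; lra.
  lra.
apply: le_trans h1 _; rewrite -mulr_sumr.
rewrite -(bigA_distr_bigA (fun _ => g)) /= prodr_const card_prod card_bool card_ord.
have h2 : \sum_sa g sa <= expR (4 * n%:R ^- 8).
  by apply: le_trans (one_coord_weight_le R j n2) _; exact: expR_ge1Dx.
(* [(1 + 4 n^-8)^(2n) <= exp (8 n^-7)] and [8 n^-7 <= 1 / 2 <= ln n]. *)
have h3 : (\sum_sa g sa) ^+ (n * 2) <= expR b.
  rewrite (@le_trans _ _ (expR (4 * n%:R ^- 8) ^+ (n * 2))) //.
    by rewrite lerXn2r ?nnegrE ?expR_ge0 // sumr_ge0.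
  rewrite -expRM_natl ler_expR.
  have -> : (n * 2)%:R * (4 * n%:R ^- 8) = 8 * n%:R ^- 7 :> R.
    by rewrite natrM; field; rewrite gt_eqF.
  apply: le_trans b2; rewrite ler_pdivrMr ?exprn_gt0 //.
  have : 2 ^+ 7 <= n%:R ^+ 7 :> R by rewrite lerXn2r ?nnegrE ?ler_nat // ltW.
  lra.
apply: le_trans (ler_wpM2l (expR_ge0 _) h3) _.
rewrite -expRD; apply: le_trans (expRN_nat_le _ _); rewrite ler_expR.
have h4 : (j.+1 <= 4 ^ j)%N by exact: ltn_expl.
have h5 : (5 * j.+1)%:R <= (4 ^ j)%:R * 5 :> R by rewrite mulrC -natrM ler_nat leq_mul2l.
have h6 : 1 <= (4 ^ j)%:R :> R by rewrite ler1n expn_gt0.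
have h7 : 2^-1 * (4 ^ j)%:R <= b * (4 ^ j)%:R by rewrite ler_wpM2r //.
have h8 : b <= b * (4 ^ j)%:R by rewrite ler_peMr //; lra.
lra.
Qed.

Lemma expR_threshold_le (R : realType) (n j : nat) (m : lattice n j) :
  expR (- threshold R m ^+ 2) <= expR (- threshold_dense R n j ^+ 2) +
    (if sparse m then expR (- threshold_sparse R n j ^+ 2) else 0).
Proof.
rewrite /threshold; case: ifP => _; last by rewrite addr0.
by rewrite /Num.min; case: ifP => _; rewrite ?lerDl ?lerDr expR_ge0.
Qed.

Lemma lattice_union_bound (R : realType) (n L : nat) : (2 <= n)%N ->
  \sum_(j < L) \sum_(m : lattice n j) 4 * expR (- threshold R m ^+ 2) <= 1.
Proof.
move=> n2.
apply: (@le_trans _ _ (\sum_(j < L) 4^-1 * (2^-1) ^+ j)); last first.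
  have h : (0 <= 2^-1 :> R) && (2^-1 <= 2^-1 :> R) by apply/andP; split; lra.
  by rewrite -mulr_sumr; have := geom_sum_le L h; lra.
apply: ler_sum => j _; rewrite -mulr_sumr.
have h1 : \sum_(m : lattice n j) expR (- threshold R m ^+ 2) <= 2 * 2 ^- (5 * j.+1).
  apply: le_trans (ler_sum _ (fun m _ => expR_threshold_le R m)) _.
  rewrite big_split /= -big_mkcond /=.
  have n0 : (0 < n)%N by lia.
  by have := dense_weight_le R j n0; have := sparse_weight_le R j n2; lra.
have h2 : 2 ^- (5 * j.+1) <= 2^-1 ^+ 5 * (2^-1) ^+ j :> R.
  rewrite -exprVn mulnS exprD ler_wpM2l ?exprn_ge0 ?invr_ge0 //.
  by apply: ler_wiXn2l; rewrite ?invr_ge0 ?invf_le1 ?ler1n //; lia.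
lra.
Qed.

(** * Chaining along dyadic roundings *)

Definition lat_point (R : realType) (n j : nat) (m : lattice n j) (i : 'I_n) : R[i] :=
  Complex (dyad R j (m (i, false)).1 (m (i, false)).2)
          (dyad R j (m (i, true)).1 (m (i, true)).2).

(** The same point rounded to the grid of the previous level, which is
    the origin when [j = 0]. *)
Definition lat_parent (R : realType) (n j : nat) (m : lattice n j) (i : 'I_n) : R[i] :=
  Complex (dyad R j (m (i, false)).1 ((m (i, false)).2)./2.*2)
          (dyad R j (m (i, true)).1 ((m (i, true)).2)./2.*2).

Definition coord (R : realType) (b : bool) (z : R[i]) : R := if b then Im z else Re z.

(** The sign of a coordinate that is rounded to zero is normalized, as
    [sparse] requires. *)
Definition lat_round (R : realType) (n j : nat) (z : 'I_n -> R[i]) : lattice n j :=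
  [ffun ib => let x := coord ib.2 (z ib.1) in
     ((x < 0) && (trunc_level j x != 0%N), inord (trunc_level j x))].

Lemma norm_coord_le (R : realType) (b : bool) (z : R[i]) : `|coord b z| <= normc z.
Proof.
rewrite -(@ler_pXn2r _ 2) ?nnegrE ?normc_ge0 // sqr_normc -normrX.
by rewrite (ger0_norm (sqr_ge0 _)); case: b; rewrite /coord ?lerDl ?lerDr sqr_ge0.
Qed.

Lemma normc_mono (R : realType) (z w : R[i]) :
  `|Re z| <= `|Re w| -> `|Im z| <= `|Im w| -> normc z <= normc w.
Proof.
move=> h1 h2; rewrite -(@ler_pXn2r _ 2) ?nnegrE ?normc_ge0 // !sqr_normc.
by apply: lerD; rewrite -[leLHS](real_normK (num_real _))
  -[leRHS](real_normK (num_real _)) lerXn2r ?nnegrE.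
Qed.

Lemma normc_le_sqrt2 (R : realType) (z : R[i]) (e : R) :
  `|Re z| <= e -> `|Im z| <= e -> normc z <= Num.sqrt 2 * e.
Proof.
move=> h1 h2; have e0 : 0 <= e by apply: le_trans h1.
rewrite -(@ler_pXn2r _ 2) ?nnegrE ?normc_ge0 ?mulr_ge0 ?sqrtr_ge0 //.
rewrite sqr_normc exprMn sqr_sqrtr // -(real_normK (num_real (Re z))).
rewrite -(real_normK (num_real (Im z))).
have k1 : `|Re z| ^+ 2 <= e ^+ 2 by rewrite lerXn2r ?nnegrE.
have k2 : `|Im z| ^+ 2 <= e ^+ 2 by rewrite lerXn2r ?nnegrE.
lra.
Qed.

Lemma dyad_round_coord (R : realType) (n j : nat) (z : 'I_n -> R[i]) (i : 'I_n)
    (b : bool) : normc (z i) <= 1 ->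
  dyad R j (lat_round j z (i, b)).1 (lat_round j z (i, b)).2 =
    round_dyad j (coord b (z i)) /\
  ((lat_round j z (i, b)).2 = trunc_level j (coord b (z i)) :> nat).
Proof.
move=> h; have hx : `|coord b (z i)| <= 1 by apply: le_trans h; exact: norm_coord_le.
rewrite /lat_round ffunE /= inordK ?ltnS ?trunc_level_le //; split=> //.
rewrite /round_dyad; case: (eqVneq (trunc_level j (coord b (z i))) 0%N) => [->|_].
  by rewrite /dyad !mulr0.
by rewrite andbT.
Qed.

Lemma lat_point_round (R : realType) (n j : nat) (z : 'I_n -> R[i]) (i : 'I_n) :
  normc (z i) <= 1 ->
  lat_point R (lat_round j z) i =
  Complex (round_dyad j (Re (z i))) (round_dyad j (Im (z i))).
Proof.
move=> h; rewrite /lat_point.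
by rewrite (dyad_round_coord j false h).1 (dyad_round_coord j true h).1.
Qed.

Lemma dyad_round_half (R : realType) (n j : nat) (z : 'I_n -> R[i]) (i : 'I_n)
    (b : bool) : normc (z i) <= 1 ->
  dyad R j.+1 (lat_round j.+1 z (i, b)).1 ((lat_round j.+1 z (i, b)).2)./2.*2 =
  round_dyad j (coord b (z i)).
Proof.
move=> h; rewrite (dyad_round_coord j.+1 b h).2 trunc_level_half dyadS.
rewrite /lat_round ffunE /=.
rewrite /round_dyad; case: (eqVneq (trunc_level j (coord b (z i))) 0%N) => [->|h0].
  by rewrite /dyad !mulr0.
suff -> : trunc_level j.+1 (coord b (z i)) != 0%N by rewrite andbT.
by apply: contraNneq h0 => h1; rewrite -trunc_level_half h1.
Qed.

Lemma lat_parent_roundS (R : realType) (n j : nat) (z : 'I_n -> R[i]) (i : 'I_n) :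
  normc (z i) <= 1 -> lat_parent R (lat_round j.+1 z) i = lat_point R (lat_round j z) i.
Proof.
by move=> h; rewrite lat_point_round // /lat_parent !dyad_round_half.
Qed.

(** Coordinates of level [0] are [-1], [0] or [1], so they halve to [0]: every
    chain starts at the origin. *)
Lemma lat_parent0 (R : realType) (n : nat) (m : lattice n 0) (i : 'I_n) :
  lat_parent R m i = 0.
Proof.
have h ib : ((m ib).2)./2 = 0%N.
  by case: (m ib) => s [[|[|[]]]].
by rewrite /lat_parent !h /dyad !mulr0 !mul0r.
Qed.

Lemma normc_round_le (R : realType) (n j : nat) (z : 'I_n -> R[i]) (i : 'I_n) :
  normc (z i) <= 1 -> normc (lat_point R (lat_round j z) i) <= normc (z i).
Proof.
by move=> h; rewrite lat_point_round //; apply: normc_mono; exact: norm_round_le.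
Qed.

Lemma normc_parent_le (R : realType) (n j : nat) (m : lattice n j) (i : 'I_n) :
  normc (lat_parent R m i) <= normc (lat_point R m i).
Proof. by apply: normc_mono; exact: norm_dyad_half_le. Qed.

Lemma normc_pointB_parent (R : realType) (n j : nat) (m : lattice n j) (i : 'I_n) :
  normc (lat_point R m i - lat_parent R m i) <= Num.sqrt 2 * 2 ^- j.
Proof. by apply: normc_le_sqrt2; exact: norm_dyadB_half. Qed.

Lemma normc_subr_round (R : realType) (n j : nat) (z : 'I_n -> R[i]) (i : 'I_n) :
  normc (z i) <= 1 -> normc (z i - lat_point R (lat_round j z) i) <= Num.sqrt 2 * 2 ^- j.
Proof.
move=> h; rewrite lat_point_round //; apply: normc_le_sqrt2;
  by case: (z i) => a b /=; exact: norm_subr_round.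
Qed.

Lemma sum_sqr_coord (R : realType) (n : nat) (z : 'I_n -> R[i]) :
  \sum_ib coord ib.2 (z ib.1) ^+ 2 = \sum_i normc (z i) ^+ 2.
Proof.
rewrite -(pair_bigA _ (fun i b => coord b (z i) ^+ 2)) /=; apply: eq_bigr => i _.
by rewrite big_bool /= sqr_normc addrC.
Qed.

Lemma sparse_round (R : realType) (n j : nat) (z : 'I_n -> R[i]) :
  \sum_i normc (z i) ^+ 2 <= 1 -> sparse (lat_round j z).
Proof.
move=> hz.
have z1 i : normc (z i) <= 1.
  rewrite -(@ler_pXn2r _ 2) ?nnegrE ?normc_ge0 // expr1n; apply: le_trans hz.
  by rewrite (bigD1 i) //= lerDl sumr_ge0 // => l _; exact: sqr_ge0.
apply/andP; split.
  apply/forallP => -[i b]; rewrite (dyad_round_coord j b (z1 i)).2 /lat_round ffunE /=.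
  by case: (_ == _) => //; rewrite andbF.
rewrite -(ler_nat R) /height natr_sum.
apply: (@le_trans _ _ (\sum_ib coord ib.2 (z ib.1) ^+ 2 * (2 ^+ j) ^+ 2)).
  apply: ler_sum => -[i b] _ /=; rewrite (dyad_round_coord j b (z1 i)).2 natrX.
  rewrite -exprMn -[leRHS](real_normK (num_real _)) lerXn2r ?nnegrE //.
  rewrite normrM (ger0_norm (exprn_ge0 _ _)) // /trunc_level truncn_le.
  by rewrite mulr_ge0 // exprn_ge0.
rewrite -mulr_suml sum_sqr_coord natrX exprAC -natrX ler_piMl //.
Qed.

(** The signed polynomial as a function of a family of coordinates, with
    its signs encoded by booleans. *)
Definition block_sum (R : realType) (n : nat) (S : {set {set 'I_n}})
    (c : {ffun {set 'I_n} -> bool}) (z : 'I_n -> R[i]) : R[i] :=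
  \sum_(J in S) (-1) ^+ c J * \prod_(i in J) z i.

Lemma threshold_gt0 (R : realType) (n j : nat) (m : lattice n j) : (2 <= n)%N ->
  0 < threshold R m.
Proof.
move=> n2; have h1 : 0 < threshold_dense R n j.
  by rewrite !mulr_gt0 // sqrtr_gt0 ltr0n; lia.
have h2 : 0 < threshold_sparse R n j.
  by rewrite !mulr_gt0 ?exprn_gt0 // sqrtr_gt0 (lt_le_trans _ (ln_nat_ge R n2)).
by rewrite /threshold; case: ifP => // _; rewrite lt_min h1 h2.
Qed.

(** One choice of signs controls all links of all chains up to
    level [L].  The radius [s] is chosen after the signs, which lets the same
    signs serve the [l_2] ball ([s = 1]) and the [l_oo] ball ([s = n]). *)
Lemma exists_good_signs (R : realType) (n k L : nat) (S : {set {set 'I_n}}) :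
  (2 <= n)%N -> (0 < k)%N -> partial_steiner k k.+1 S ->
  exists c : {ffun {set 'I_n} -> bool},
    forall (j : nat) (m : lattice n j) (s : R), (j < L)%N ->
    \sum_i normc (lat_point R m i) ^+ 2 <= s ->
    normc (block_sum S c (lat_point R m) - block_sum S c (lat_parent R m)) <=
    12 * threshold R m * 2 ^- j * Num.sqrt (s ^+ k).
Proof.
move=> n2 k0 hS.
pose I : finType := {j : 'I_L & lattice n j}.
pose D (i : I) (J : {set 'I_n}) : R[i] := if J \in S then
  \prod_(l in J) lat_point R (tagged i) l - \prod_(l in J) lat_parent R (tagged i) l else 0.
pose sigma (i : I) := Num.sqrt (\sum_J normc (D i J) ^+ 2).
have sum0 i : 0 <= \sum_J normc (D i J) ^+ 2 by apply: sumr_ge0 => J _; exact: sqr_ge0.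
have [|||| c hc] := @random_signs_complex R _ I D (fun i => threshold R (tagged i)) sigma.
- by move=> i; exact: threshold_gt0.
- by move=> i; exact: sqrtr_ge0.
- by move=> i; rewrite sqr_sqrtr.
- have := lattice_union_bound R L n2; rewrite sig_big_dep //.
exists c => j m s jL hs.
have := hc (Tagged (fun j : 'I_L => lattice n j) (m : lattice n (Ordinal jL))).
have -> : \sum_J (-1) ^+ c J * D (Tagged (fun j : 'I_L => lattice n j)
    (m : lattice n (Ordinal jL))) J =
    block_sum S c (lat_point R m) - block_sum S c (lat_parent R m).
  rewrite /block_sum -sumrB [RHS]big_mkcond /=; apply: eq_bigr => J _.
  by rewrite /D /=; case: ifP => _; rewrite ?mulr0 // mulrBr.
move=> h; apply: (le_trans h); rewrite /=.
have s0 : 0 <= s by apply: le_trans hs; apply: sumr_ge0 => i _; exact: sqr_ge0.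
have hsig : sigma (Tagged (fun j : 'I_L => lattice n j)
    (m : lattice n (Ordinal jL))) <= 2 * 2 ^- j * Num.sqrt (s ^+ k).
  rewrite /sigma -(@ler_pXn2r _ 2) ?nnegrE ?sqrtr_ge0 //.
  rewrite sqr_sqrtr // !exprMn sqr_sqrtr ?exprn_ge0 //.
  have -> : \sum_J normc (D (Tagged (fun j : 'I_L => lattice n j)
      (m : lattice n (Ordinal jL))) J) ^+ 2 =
      \sum_(J in S) normc (\prod_(l in J) lat_point R m l -
                            \prod_(l in J) lat_parent R m l) ^+ 2.
    rewrite [RHS]big_mkcond /=; apply: eq_bigr => J _.
    by rewrite /D /=; case: ifP => _ //; rewrite Normc.normc0 expr0n.
  apply: le_trans (steiner_increment_le k0 hS (normc_parent_le R m)
    (normc_pointB_parent R m) hs) _.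
  by rewrite exprMn sqr_sqrtr // le_eqVlt; apply/orP; left; apply/eqP; ring.
have t0 := ltW (threshold_gt0 R m n2).
apply: le_trans (ler_wpM2l _ hsig) _; first by rewrite mulr_ge0.
by rewrite le_eqVlt; apply/orP; left; apply/eqP; ring.
Qed.

Lemma block_sum_telescope (R : realType) (n k L : nat) (S : {set {set 'I_n}})
    (c : {ffun {set 'I_n} -> bool}) (z : 'I_n -> R[i]) :
  (forall J, J \in S -> #|J| = k.+1) -> (forall i, normc (z i) <= 1) ->
  \sum_(j < L.+1) (block_sum S c (lat_point R (lat_round j z)) -
                   block_sum S c (lat_parent R (lat_round j z))) =
  block_sum S c (lat_point R (lat_round L z)).
Proof.
move=> hS hz.
have e0 : block_sum S c (lat_parent R (lat_round 0 z)) = 0.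
  rewrite /block_sum big1 // => J JS.
  have /card_gt0P[i iJ] : (0 < #|J|)%N by rewrite hS.
  by rewrite (bigD1 i) //= lat_parent0 mul0r mulr0.
elim: L => [|L IH]; first by rewrite big_ord_recr big_ord0 /= e0 subr0 add0r.
rewrite big_ord_recr /= IH.
have -> : block_sum S c (lat_parent R (lat_round L.+1 z)) =
   block_sum S c (lat_point R (lat_round L z)).
  apply: eq_bigr => J _; congr (_ * _); apply: eq_bigr => i _.
  by rewrite lat_parent_roundS.
by rewrite subrKC.
Qed.

(** The chain is cut at a finite level; this crude deterministic
    bound, with a factor [#|S|], is made small by going far enough. *)
Lemma block_sum_approx (R : realType) (n k j : nat) (S : {set {set 'I_n}})
    (c : {ffun {set 'I_n} -> bool}) (z : 'I_n -> R[i]) :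
  (forall J, J \in S -> #|J| = k.+1) -> (forall i, normc (z i) <= 1) ->
  normc (block_sum S c z) <= normc (block_sum S c (lat_point R (lat_round j z))) +
     2 * (#|S| * k.+1)%:R * 2 ^- j.
Proof.
move=> hS hz.
have -> : block_sum S c z = block_sum S c (lat_point R (lat_round j z)) +
   (block_sum S c z - block_sum S c (lat_point R (lat_round j z))) by ring.
apply: le_trans (normcD_le _ _) _; rewrite lerD2l /block_sum -sumrB.
apply: le_trans (normc_sum_le _ _ _) _.
have -> : 2 * (#|S| * k.+1)%:R * 2 ^- j = \sum_(J in S) (2 * 2 ^- j * k.+1%:R) :> R.
  by rewrite sumr_const -[RHS]mulr_natl natrM; ring.
apply: ler_sum => J JS; rewrite -mulrBr Normc.normcM.
have -> : normc ((-1) ^+ c J : R[i]) = 1.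
  by case: (c J); rewrite ?expr0 ?expr1 ?normcN Normc.normc1.
rewrite mul1r.
have s2 : Num.sqrt 2 * 2 ^- j <= 2 * 2 ^- j :> R.
  rewrite ler_wpM2r ?invr_ge0 ?exprn_ge0 //.
  by rewrite -(@ler_pXn2r _ 2) ?nnegrE ?sqrtr_ge0 // sqr_sqrtr //; lra.
have h1 := fun i => normc_round_le j (hz i).
have h2 := fun i => le_trans (normc_subr_round j (hz i)) s2.
apply: le_trans (normc_prodB_le J (fun i => lexx (normc (z i))) h1 h2) _.
rewrite ler_wpM2l ?mulr_ge0 ?invr_ge0 ?exprn_ge0 //.
rewrite -(hS _ JS) -sum1_card natr_sum; apply: ler_sum => l _.
by rewrite prodr_ile1 // => i _; rewrite normc_ge0 hz.
Qed.

(** * Signs that are good on the three balls *)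

Lemma arith_geom_sum_le (R : realType) (a N : nat) : (a <= N)%N ->
  \sum_(a <= j < N) (j.+1%:R * 2 ^- j) <= (2 * a + 4)%:R * 2 ^- a :> R.
Proof.
move=> aN; have p (m : nat) : 0 < 2 ^- m :> R by rewrite invr_gt0 exprn_gt0.
suff e : \sum_(a <= j < N) (j.+1%:R * 2 ^- j) =
    (2 * a + 4)%:R * 2 ^- a - (2 * N + 4)%:R * 2 ^- N :> R.
  by rewrite e lerBlDr lerDl mulr_ge0 // ltW.
rewrite -(subnKC aN); elim: (N - a)%N => [|d IH].
  by rewrite addn0 big_geq // subrr.
rewrite addnS big_nat_recr ?leq_addr //= IH.
move: (a + d)%N => m; have q := p m.
have -> : 2 ^- m.+1 = 2^-1 * 2 ^- m :> R by rewrite exprS invfM.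
rewrite !natrD !natrM -[m.+1%:R]natr1; field.
by rewrite !expf_neq0.
Qed.

(** The two Dudley sums.  Level [a] is the first one with
    [n < 4^a]; below it the sparse threshold makes each link cost
    [O(sqrt(log n))], from it on the dense threshold gives a convergent sum. *)
Lemma exists_signs_l2_linf (R : realType) (n k : nat) (S : {set {set 'I_n}}) :
  (2 <= n)%N -> (0 < k)%N -> partial_steiner k k.+1 S ->
  exists c : {ffun {set 'I_n} -> bool},
    (forall z : 'I_n -> R[i], (forall i, normc (z i) <= 1) ->
       normc (block_sum S c z) <= 200 * Num.sqrt (n%:R ^+ k.+1)) /\
    (forall z : 'I_n -> R[i], \sum_i normc (z i) ^+ 2 <= 1 ->
       normc (block_sum S c z) <= 1600 * (ln n%:R * Num.sqrt (ln n%:R))).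
Proof.
move=> n2 k0 hS; pose b : R := ln n%:R; pose rb := Num.sqrt b.
have n0 : 0 < n%:R :> R by rewrite ltr0n; lia.
have n1 : 1 <= n%:R :> R by rewrite ler1n; lia.
have b2 : 2^-1 <= b by exact: ln_nat_ge.
have rb2 : rb ^+ 2 = b by rewrite sqr_sqrtr //; lra.
have rb1 : 2^-1 <= rb.
  by rewrite -(@ler_pXn2r _ 2) ?nnegrE ?sqrtr_ge0 // rb2; lra.
pose t := trunc_log 4 n; pose a := t.+1.
have /andP[t1 t2] : (4 ^ t <= n < 4 ^ a)%N by apply: trunc_log_bounds; lia.
have tb : t%:R <= b.
  have h4 : 1 <= ln 4 :> R.
    rewrite (_ : 4 = 2 ^+ 2 :> R); last by ring.
    by rewrite lnXn // mulr2n; have := ln_nat_ge R (isT : (2 <= 2)%N); lra.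
  apply: (@le_trans _ _ (ln ((4 ^ t)%:R))).
    by rewrite natrX lnXn // -[leRHS]mulr_natr ler_peMl.
  by rewrite ler_ln ?posrE ?ler_nat // ltr0n expn_gt0.
have ab : a%:R <= 3 * b by rewrite /a -natr1; lra.
have na : Num.sqrt n%:R <= 2 ^+ a :> R.
  rewrite -(@ler_pXn2r _ 2) ?nnegrE ?sqrtr_ge0 ?exprn_ge0 // sqr_sqrtr //.
  by rewrite exprAC -!natrX ler_nat ltnW.
(* [2^L >= L] makes the truncation error at level [L] at most [1 / 4]. *)
have [L [aL hL]] : exists L, (a <= L)%N /\ 2 * (#|S| * k.+1)%:R * 2 ^- L <= 4^-1 :> R.
  exists (a + 8 * (#|S| * k.+1))%N; split; first exact: leq_addr.
  have : (8 * (#|S| * k.+1) <= 2 ^ (a + 8 * (#|S| * k.+1)))%N.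
    by apply: leq_trans (ltnW (ltn_expl _ (isT : 1 < 2)%N)); exact: leq_addl.
  rewrite ler_pdivrMr ?exprn_gt0 //.
  move: (#|S| * k.+1)%N => m; move: (a + _)%N => l; rewrite -(ler_nat R) natrM natrX.
  by move: (2 ^+ l) => y; lra.
have [c hc] := @exists_good_signs R n k L.+1 S n2 k0 hS.
have chain (z : 'I_n -> R[i]) (s : R) (i1 : forall i, normc (z i) <= 1) :
    \sum_i normc (z i) ^+ 2 <= s ->
    normc (block_sum S c z) <= 4^-1 +
    \sum_(0 <= j < L.+1) 12 * threshold R (lat_round j z) * 2 ^- j * Num.sqrt (s ^+ k).
  move=> hs; apply: le_trans (block_sum_approx L c hS.1 i1) _.
  rewrite addrC; apply: lerD; first exact: hL.
  rewrite -(block_sum_telescope L c hS.1 i1) big_mkord.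
  apply: le_trans (normc_sum_le _ _ _) _; apply: ler_sum => j _.
  apply: hc => //; apply: le_trans hs; apply: ler_sum => i _.
  by rewrite lerXn2r ?nnegrE ?normc_ge0 // normc_round_le.
have p (m : nat) : 0 < 2 ^- m :> R by rewrite invr_gt0 exprn_gt0.
have threshold_le_dense j (m : lattice n j) : threshold R m <= threshold_dense R n j.
  by rewrite /threshold; case: ifP => // _; rewrite ge_min lexx.
exists c; split=> z hz.
  have hs : \sum_i normc (z i) ^+ 2 <= n%:R.
    rewrite -[X in X%:R]card_ord -sum1_card natr_sum; apply: ler_sum => i _.
    by rewrite expr_le1 ?normc_ge0.
  apply: le_trans (chain z _ hz hs) _.
  have e : Num.sqrt (n%:R ^+ k.+1) = Num.sqrt n%:R * Num.sqrt (n%:R ^+ k) :> R.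
    by rewrite exprS sqrtrM.
  have g1 : 1 <= Num.sqrt (n%:R ^+ k.+1) :> R.
    by rewrite -[leLHS]sqrtr1 ler_wsqrtr // exprn_ege1.
  have : \sum_(0 <= j < L.+1) 12 * threshold R (lat_round j z) * 2 ^- j * Num.sqrt (n%:R ^+ k) <=
      48 * Num.sqrt (n%:R ^+ k.+1) * \sum_(0 <= j < L.+1) (j.+1%:R * 2 ^- j).
    rewrite mulr_sumr; apply: ler_sum => j _.
    have -> : 48 * Num.sqrt (n%:R ^+ k.+1) * (j.+1%:R / 2 ^+ j) =
       12 * threshold_dense R n j * 2 ^- j * Num.sqrt (n%:R ^+ k).
      by rewrite e /threshold_dense; ring.
    rewrite ler_wpM2r ?sqrtr_ge0 // ler_wpM2r ?(ltW (p _)) // ler_wpM2l //.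
  have := @arith_geom_sum_le R 0 L.+1 isT; rewrite expr0 invr1 mulr1 => h1 h2.
  have : 48 * Num.sqrt (n%:R ^+ k.+1) * \sum_(0 <= j < L.+1) (j.+1%:R * 2 ^- j)
      <= 48 * Num.sqrt (n%:R ^+ k.+1) * 4 :> R.
    by rewrite ler_wpM2l ?mulr_ge0 ?sqrtr_ge0.
  lra.
have hz1 i : normc (z i) <= 1.
  rewrite -(@ler_pXn2r _ 2) ?nnegrE ?normc_ge0 // expr1n; apply: le_trans hz.
  by rewrite (bigD1 i) //= lerDl sumr_ge0 // => l _; exact: sqr_ge0.
apply: le_trans (chain z _ hz1 hz) _; rewrite expr1n sqrtr1.
under eq_bigr do rewrite mulr1.
move/leqW: aL => aL.
rewrite (@big_cat_nat _ _ _ a) //=.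
have low : \sum_(0 <= j < a) 12 * threshold R (lat_round j z) * 2 ^- j <=
    a%:R * (60 * rb).
  have -> : a%:R * (60 * rb) = \sum_(0 <= j < a) (60 * rb).
    by rewrite sumr_const_nat subn0 mulr_natl.
  apply: ler_sum => j _.
  apply: (@le_trans _ _ (12 * threshold_sparse R n j * 2 ^- j)).
    rewrite ler_wpM2r ?(ltW (p _)) // ler_wpM2l // /threshold sparse_round //.
    by rewrite ge_min lexx orbT.
  rewrite /threshold_sparse -/b -/rb le_eqVlt; apply/orP; left; apply/eqP.
  by field; rewrite expf_eq0 pnatr_eq0 andbF.
have high : \sum_(a <= j < L.+1) 12 * threshold R (lat_round j z) * 2 ^- j <=
    48 * (2 * a + 4)%:R.
  apply: (@le_trans _ _ (48 * Num.sqrt n%:R * \sum_(a <= j < L.+1) (j.+1%:R * 2 ^- j))).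
    rewrite mulr_sumr; apply: ler_sum => j _.
    have -> : 48 * Num.sqrt n%:R * (j.+1%:R / 2 ^+ j) = 12 * threshold_dense R n j * 2 ^- j.
      by rewrite /threshold_dense; ring.
    by rewrite ler_wpM2r ?(ltW (p _)) // ler_wpM2l.
  have h := @arith_geom_sum_le R _ _ aL.
  apply: le_trans (ler_wpM2l _ h) _; first by rewrite mulr_ge0 ?sqrtr_ge0.
  have -> : 48 * Num.sqrt n%:R * ((2 * a + 4)%:R * 2 ^- a) =
     48 * (2 * a + 4)%:R * (Num.sqrt n%:R * 2 ^- a) :> R by ring.
  by rewrite ler_piMr // ler_pdivrMr ?exprn_gt0 // mul1r.
have e24 : (2 * a + 4)%:R = 2 * a%:R + 4 :> R by rewrite natrD natrM.
rewrite e24 in high; rewrite -/b -/rb.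
have k1 : a%:R * (60 * rb) <= 3 * b * (60 * rb).
  by rewrite ler_wpM2r // mulr_ge0 // sqrtr_ge0.
have k2 : b <= 2 * (b * rb).
  have : b * 2^-1 <= b * rb by rewrite ler_wpM2l //; lra.
  lra.
lra.
Qed.

(** The triangle inequality suffices on the [l_1] ball, because the sum of all
    square-free monomials of degree [k+1] in the moduli is at most [1] there. *)
Lemma block_sum_l1 (R : realType) (n k : nat) (S : {set {set 'I_n}})
    (c : {ffun {set 'I_n} -> bool}) (z : 'I_n -> R[i]) :
  (forall J, J \in S -> #|J| = k.+1) -> \sum_i normc (z i) <= 1 ->
  normc (block_sum S c z) <= 1.
Proof.
move=> hS hz; apply: (@le_trans _ _ (elem_sym k.+1 (fun i => normc (z i)))).
  apply: le_trans (normc_sum_le _ _ _) _; rewrite /elem_sym.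
  rewrite [leLHS]big_mkcond [leRHS]big_mkcond /=; apply: ler_sum => J _.
  case: ifP => [JS|_]; last first.
    by case: ifP => // _; apply: prodr_ge0 => i _; exact: normc_ge0.
  rewrite hS // eqxx Normc.normcM normc_prod.
  by case: (c J); rewrite ?expr0 ?expr1 ?normcN Normc.normc1 mul1r.
have := elem_sym_le k (fun i => normc_ge0 (z i)) hz; rewrite expr1n.
apply: le_trans; rewrite ler_peMl ?ler1n // elem_sym_ge0 // => i.
exact: normc_ge0.
Qed.

(** * The three lines theorem for exponential sums *)

Lemma sin_le_id (R : realType) (s : R) : 0 <= s -> sin s <= s.
Proof.
rewrite le_eqVlt => /orP[/eqP <-|s0]; first by rewrite sin0.
have [|c _] := @MVT R (@sin R) (@cos R) 0 s s0.
  by apply: continuous_subspaceT => x; exact: continuous_sin.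
rewrite sin0 !subr0 => ->; by rewrite -[leRHS]mul1r ler_wpM2r ?cos_le1 // ltW.
Qed.

(** By the mean value theorem and [cos c = 1 - 2 (sin (c/2))^2 >= 1 - c]. *)
Lemma sin_ge_quadratic (R : realType) (s : R) : 0 <= s <= 1 -> s - s ^+ 2 <= sin s.
Proof.
rewrite le_eqVlt => /andP[/orP[/eqP <- _|s0 s1]]; first by rewrite sin0 expr0n subr0.
have [|c] := @MVT R (@sin R) (@cos R) 0 s s0.
  by apply: continuous_subspaceT => x; exact: continuous_sin.
rewrite in_itv /= => /andP[c0 cs]; rewrite sin0 !subr0 => ->.
have h1 : sin (c / 2) <= c / 2 by apply: sin_le_id; lra.
have h2 : 0 <= sin (c / 2) by apply: sin_ge0_pi; have := pi_ge2 R; lra.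
have h3 := cos_mulr2n (c / 2); rewrite cos2sin2 in h3.
have hc : c / 2 *+ 2 = c by rewrite -mulr_natr; field.
rewrite hc in h3; have : sin (c / 2) ^+ 2 <= (c / 2) ^+ 2.
  by rewrite lerXn2r ?nnegrE //; lra.
rewrite h3; move: (sin _ ^+ 2) => q hq; nra.
Qed.

(** The second order terms of [2 cosh t] and [2 cos t] cancel.  With [t = 2 s],
    [2 cosh t - 2] is the square of [exp s - exp (- s)] and [2 - 2 cos t] that
    of [2 sin s], and both roots are [2 s + O(s^2)]. *)
Lemma cosh_cos_approx (R : realType) (t : R) : `|t| <= 1 ->
  `|expR t + expR (- t) + 2 * cos t - 4| <= 3 * `|t| ^+ 3.
Proof.
have -> : expR t + expR (- t) + 2 * cos t - 4 =
   expR `|t| + expR (- `|t|) + 2 * cos `|t| - 4.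
  by rewrite cos_norm; case: (leP 0 t) => t0;
    [rewrite ger0_norm | rewrite ltr0_norm // opprK (addrC (expR t))].
move: (normr_ge0 t); move: `|t| => {}t t0 t1.
pose s := t / 2; have -> : t = s *+ 2 by rewrite /s -mulr_natr; field.
have s0 : 0 <= s by rewrite /s; lra.
have s1 : s <= 2^-1 by rewrite /s; lra.
have e2 (u : R) : expR (u *+ 2) = expR u ^+ 2 by rewrite -mulr_natl expRM_natl.
clearbody s; rewrite -mulNrn cos_mulr2n !e2 cos2sin2.
have hS1 : sin s <= s by exact: sin_le_id.
have hS2 : s - s ^+ 2 <= sin s by apply: sin_ge_quadratic; rewrite s0; lra.
have hab : expR s * expR (- s) = 1 by rewrite -expRD subrr expR0.
have a1 := expR_ge1Dx s; have b1 := expR_ge1Dx (- s).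
move: {t t0 t1} (expR s) (expR (- s)) (sin s) hab a1 b1 hS1 hS2.
move: s s0 s1 => s s0 s1 a b S hab a1 b1 hS1 hS2.
have a2 : a <= 1 + s + 2 * s ^+ 2.
  have : a * (1 - s) <= 1 by rewrite -[leRHS]hab ler_wpM2l //; lra.
  nra.
have b2 : b <= 1 - s + s ^+ 2.
  have : b * (1 + s) <= 1 by rewrite -[leRHS]hab [leRHS]mulrC ler_wpM2l //; lra.
  nra.
have d1 : 2 * s - s ^+ 2 <= a - b by lra.
have d2 : a - b <= 2 * s + 2 * s ^+ 2 by lra.
have e : a ^+ 2 + b ^+ 2 = (a - b) ^+ 2 + 2 by rewrite sqrrB hab; ring.
have f1 : (a - b) ^+ 2 <= (2 * s + 2 * s ^+ 2) ^+ 2.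
  by rewrite lerXn2r ?nnegrE; nra.
have f2 : (2 * s - s ^+ 2) ^+ 2 <= (a - b) ^+ 2.
  by rewrite lerXn2r ?nnegrE; nra.
have f3 : S ^+ 2 <= s ^+ 2 by rewrite lerXn2r ?nnegrE; nra.
have f4 : (s - s ^+ 2) ^+ 2 <= S ^+ 2 by rewrite lerXn2r ?nnegrE; nra.
rewrite e; move: ((a - b) ^+ 2) (S ^+ 2) f1 f2 f3 f4 => p q f1 f2 f3 f4.
have s3 : 0 <= s ^+ 3 by rewrite exprn_ge0.
have s4 : s ^+ 4 <= s ^+ 3 by rewrite -[leRHS]mulr1 exprSr ler_wpM2l //; lra.
have s4' : 0 <= s ^+ 4 by rewrite exprn_ge0.
by rewrite ler_norml; apply/andP; split; lra.
Qed.

Definition cis (R : realType) (t : R) : R[i] := Complex (cos t) (sin t).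

Lemma cisD (R : realType) (s t : R) : cis (s + t) = cis s * cis t.
Proof. by rewrite /cis cosD sinD; congr Complex; rewrite addrC. Qed.

Lemma cis0 (R : realType) : cis (0 : R) = 1.
Proof. by rewrite /cis cos0 sin0. Qed.

Lemma normc_cis (R : realType) (t : R) : normc (cis t) = 1.
Proof. by rewrite /= cos2Dsin2 sqrtr1. Qed.

Lemma cis_sum (R : realType) (I : Type) (r : seq I) (P : pred I) (f : I -> R) :
  cis (\sum_(i <- r | P i) f i) = \prod_(i <- r | P i) cis (f i).
Proof. exact: (big_morph _ (@cisD R) (cis0 R)). Qed.

(** The entire function [\sum_t a_t exp (l_t s)] at [s = x + i y]. *)
Definition expsum (R : realType) (T : finType) (a : T -> R[i]) (l : T -> R)
    (x y : R) : R[i] :=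
  \sum_t a t * real_complex R (expR (l t * x)) * cis (l t * y).

(** A discrete Laplacian.  Each exponential is an eigenvector, and
    [cosh_cos_approx] makes the eigenvalue [O(h^3)]: this is harmonicity without
    derivatives. *)
Lemma expsum_stencil (R : realType) (T : finType) (a : T -> R[i]) (l : T -> R)
    (x y h : R) :
  expsum a l (x + h) y + expsum a l (x - h) y +
  expsum a l x (y + h) + expsum a l x (y - h) =
  4 * expsum a l x y +
  \sum_t a t * real_complex R (expR (l t * x)) * cis (l t * y) *
    real_complex R (expR (l t * h) + expR (- (l t * h)) + 2 * cos (l t * h) - 4).
Proof.
rewrite /expsum mulr_sumr -!big_split /=; apply: eq_bigr => t _.
have h4 : real_complex R 4 = 4 by exact: rmorph_nat.
have -> : real_complex R (expR (l t * h) + expR (- (l t * h)) +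
    2 * cos (l t * h) - 4) =
    real_complex R (expR (l t * h)) + real_complex R (expR (- (l t * h))) +
    (cis (l t * h) + cis (- (l t * h))) - 4.
  rewrite -h4 /cis cosN sinN; apply/eqP; rewrite eq_complex /=.
  by apply/andP; split; apply/eqP; ring.
rewrite !mulrDr !mulrN !cisD !expRD !rmorphM /=.
by ring.
Qed.

Lemma normc_expsum_term (R : realType) (a : R[i]) (x y : R) :
  normc (a * real_complex R (expR x) * cis y) = normc a * expR x.
Proof.
by rewrite !Normc.normcM normc_cis mulr1 normcR ger0_norm ?expR_ge0.
Qed.

Lemma expR_lipschitz (R : realType) (u v b : R) : u <= b -> v <= b ->
  `|expR u - expR v| <= expR b * `|u - v|.
Proof.
wlog uv : u v / v <= u => [hw ub vb|ub _].
  have [uv|/ltW uv] := leP v u; first exact: hw.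
  by rewrite distrC (distrC u); exact: hw.
rewrite !ger0_norm ?subr_ge0 ?ler_expR //.
have -> : expR u - expR v = expR u * (1 - expR (v - u)).
  by rewrite mulrBr mulr1 -expRD subrKC.
have h := expR_ge1Dx (v - u).
apply: (@le_trans _ _ (expR u * (u - v))); first by rewrite ler_pM2l ?expR_gt0 //; lra.
by rewrite ler_wpM2r ?ler_expR // subr_ge0.
Qed.

Section ThreeLines.
Variables (R : realType) (T : finType) (a : T -> R[i]) (l : T -> R).
Let F := expsum a l.
Let L := 1 + \sum_t `|l t|.
Let K := \sum_t normc (a t) * expR `|l t|.

Let L1 : 1 <= L. Proof. by rewrite lerDl sumr_ge0. Qed.
Let L0 : 0 <= L. Proof. exact: le_trans L1. Qed.
Let lL t : `|l t| <= L.
Proof.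
rewrite /L (bigD1 t) //= addrCA lerDl addr_ge0 // sumr_ge0 //.
Qed.
Let K0 : 0 <= K.
Proof. by apply: sumr_ge0 => t _; rewrite mulr_ge0 ?normc_ge0 ?expR_ge0. Qed.

Let lx_le t x : 0 <= x <= 1 -> l t * x <= `|l t|.
Proof.
move=> /andP[x0 x1]; apply: le_trans (ler_norm _) _.
by rewrite normrM (ger0_norm x0) ler_piMr.
Qed.

Let F_bound x y : 0 <= x <= 1 -> normc (F x y) <= K.
Proof.
move=> hx; apply: le_trans (normc_sum_le _ _ _) _; apply: ler_sum => t _.
by rewrite normc_expsum_term ler_wpM2l ?normc_ge0 // ler_expR lx_le.
Qed.

Let F_lip x x' y : 0 <= x <= 1 -> 0 <= x' <= 1 ->
  normc (F x y) <= normc (F x' y) + K * L * `|x - x'|.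
Proof.
move=> hx hx'; have -> : F x y = F x' y + (F x y - F x' y) by ring.
apply: le_trans (normcD_le _ _) _; rewrite lerD2l /F /expsum -sumrB.
apply: le_trans (normc_sum_le _ _ _) _.
rewrite /K -mulrA mulr_suml; apply: ler_sum => t _.
rewrite -mulrBl -mulrBr -rmorphB !Normc.normcM normc_cis mulr1 normcR -mulrA.
rewrite ler_wpM2l ?normc_ge0 //.
apply: le_trans (expR_lipschitz (lx_le _ hx) (lx_le _ hx')) _.
by rewrite ler_wpM2l ?expR_ge0 // -mulrBr normrM ler_wpM2r.
Qed.

(** The supremum over a vertical line.  Taking it removes the unbounded
    direction of the strip, so that no growth condition has to be handled. *)
Let M x := sup [set r | exists y, r = normc (F x y)]%classic.

Let M_ub x y : 0 <= x <= 1 -> normc (F x y) <= M x.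
Proof.
move=> hx; apply: ub_le_sup; last by exists y.
by exists K => _ [y' ->]; exact: F_bound.
Qed.

Let M_le x r : (forall y, normc (F x y) <= r) -> M x <= r.
Proof.
move=> h; apply: ge_sup; first by exists (normc (F x 0)); exists 0.
by move=> _ [y ->].
Qed.

(** Two of the four neighbours in the stencil lie on the same vertical line and
    are bounded by [M x] itself, which leaves midpoint convexity of [M] up to a
    term of order [h^3]. *)
Let M_conv x h : 0 <= h -> L * h <= 1 -> 0 <= x - h -> x + h <= 1 ->
  2 * M x <= M (x + h) + M (x - h) + 3 * K * L ^+ 3 * h ^+ 3.
Proof.
move=> h0 hL xh0 xh1.
suff : M x <= (M (x + h) + M (x - h) + 2 * M x + 3 * K * L ^+ 3 * h ^+ 3) / 4 by lra.
have hx : 0 <= x <= 1 by apply/andP; split; lra.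
have hxp : 0 <= x + h <= 1 by apply/andP; split; lra.
have hxm : 0 <= x - h <= 1 by apply/andP; split; lra.
apply: M_le => y; rewrite ler_pdivlMr //.
have e := expsum_stencil a l x y h; rewrite -/F in e.
set E := \sum_t _ in e.
have hE : normc E <= 3 * K * L ^+ 3 * h ^+ 3.
  apply: le_trans (normc_sum_le _ _ _) _.
  rewrite -!mulrA mulrCA /K mulr_suml; apply: ler_sum => t _.
  rewrite Normc.normcM normc_expsum_term normcR.
  have hlh : `|l t * h| <= L * h by rewrite normrM (ger0_norm h0) ler_wpM2r.
  apply: ler_pM; rewrite ?mulr_ge0 ?normc_ge0 ?expR_ge0 //.
    by rewrite ler_wpM2l ?normc_ge0 // ler_expR lx_le.
  apply: le_trans (cosh_cos_approx _) _; first exact: le_trans hL.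
  rewrite ler_wpM2l // (_ : L * _ = (L * h) ^+ 3); last by ring.
  by rewrite lerXn2r ?nnegrE // mulr_ge0.
have e4 : 4 * F x y = F (x + h) y + F (x - h) y + F x (y + h) + F x (y - h) + (- E).
  by rewrite e; ring.
have : normc (4 * F x y) <= normc (F (x + h) y) + normc (F (x - h) y) +
   normc (F x (y + h)) + normc (F x (y - h)) + normc E.
  rewrite e4 -(normcN E).
  by do 4![apply: le_trans (normcD_le _ _) _; rewrite lerD2r].
have -> : normc (4 * F x y) = normc (F x y) * 4.
  rewrite Normc.normcM (_ : 4 = real_complex R 4) ?normcR ?ger0_norm 1?mulrC //.
  exact/esym/rmorph_nat.
have := M_ub y hxp; have := M_ub y hxm.
have := M_ub (y + h) hx; have := M_ub (y - h) hx.
lra.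
Qed.

(** A maximum principle on the grid of step [1 / N]: after adding the small
    strictly convex term [c j^2], a maximum cannot be interior. *)
Let M_grid (N i : nat) : (0 < N)%N -> L <= N%:R -> (i <= N)%N ->
  (forall y, normc (F 0 y) <= 1) -> (forall y, normc (F 1 y) <= 1) ->
  M (i%:R / N%:R) <= 1 + (3 * K * L ^+ 3 + 1) / N%:R.
Proof.
move=> N0 LN iN F0 F1.
have N0' : 0 < N%:R :> R by rewrite ltr0n.
pose C := 3 * K * L ^+ 3 + 1.
have C0 : 0 < C.
  by rewrite ltr_wpDl // !mulr_ge0 // exprn_ge0.
(* The defect of midpoint convexity at [h = 1 / N] is [(C - 1) / N^3 < 2 c], and
   [c N^2 = C / N] is still small. *)
pose c := C / N%:R ^+ 3.
have c0 : 0 < c by rewrite divr_gt0 // exprn_gt0.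
pose g (j : nat) := M (j%:R / N%:R) + c * j%:R ^+ 2.
have cN : c * N%:R ^+ 2 = C / N%:R by rewrite /c; field; rewrite gt_eqF.
have end0 : g 0%N <= 1 + C / N%:R.
  rewrite /g mul0r expr0n mulr0 addr0 (le_trans (M_le F0)) // lerDl.
  by rewrite divr_ge0 ?ltW.
have endN : g N <= 1 + C / N%:R.
  by rewrite /g divff ?gt_eqF // cN lerD2r; exact: M_le.
suff gi : g i <= 1 + C / N%:R.
  apply: le_trans gi; rewrite /g lerDl mulr_ge0 ?sqr_ge0 ?ltW //.
have [im [imN' him]] : exists m : nat, (m <= N)%N /\
    forall j : nat, (j <= N)%N -> g j <= g m.
  exists [arg max_(j > ord0 : 'I_N.+1) g j]%O; split; first by rewrite -ltnS ltn_ord.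
  move=> j jN; case: arg_maxP => // m _ /(_ (inord j) isT).
  by rewrite inordK.
apply: le_trans (him i iN) _.
have [->//|im0] := eqVneq im 0%N.
have [->//|imN] := eqVneq im N.
have imlt : (im < N)%N by rewrite ltn_neqAle imN imN'.
have im0' : (0 < im)%N by rewrite lt0n.
exfalso; have h1 := him im.+1 imlt.
have h2 := him im.-1 (leq_trans (leq_pred _) (ltnW imlt)).
have h3 : 2 * M (im%:R / N%:R) <=
    M (im.+1%:R / N%:R) + M (im.-1%:R / N%:R) + C / N%:R ^+ 3 - N%:R ^- 3.
  have -> : im.+1%:R / N%:R = im%:R / N%:R + N%:R^-1 :> R.
    by rewrite -addn1 natrD mulrDl mul1r.
  have -> : im.-1%:R / N%:R = im%:R / N%:R - N%:R^-1 :> R.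
    by rewrite -{2}(prednK im0') -addn1 natrD mulrDl mul1r addrK.
  rewrite -[leRHS]addrA.
  have -> : C / N%:R ^+ 3 - N%:R ^- 3 = 3 * K * L ^+ 3 * N%:R^-1 ^+ 3.
    by rewrite /C exprVn; ring.
  apply: M_conv.
  - by rewrite invr_ge0 ltW.
  - by rewrite ler_pdivrMr // mul1r.
  - by rewrite -{1}(prednK im0') -addn1 natrD mulrDl mul1r addrK divr_ge0 // ltW.
  - rewrite -[X in _ + X]mul1r -mulrDl ler_pdivrMr // mul1r natr1 ler_nat //.
have h4 : im.+1%:R = im%:R + 1 :> R by rewrite -natr1.
have h5 : im.-1%:R = im%:R - 1 :> R by rewrite -subn1 natrB.
move: h1 h2; rewrite /g h4 h5 => h1 h2; rewrite h4 h5 in h3.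
have n3 : 0 < N%:R ^- 3 :> R by rewrite invr_gt0 exprn_gt0.
move: h1 h2 h3; rewrite -/c.
move: (M _) (M _) (M _) => m1 m2 m3 h1 h2 h3; nra.
Qed.

(** Continuity in [x] transfers the bound from the points of the
    grids [i / N], where it is [1 + O(1 / N)], to all [x]. *)
Lemma three_lines_unit (x : R) : 0 <= x <= 1 ->
  (forall y, normc (F 0 y) <= 1) -> (forall y, normc (F 1 y) <= 1) ->
  normc (F x 0) <= 1.
Proof.
move=> hx F0 F1; rewrite leNgt; apply/negP => Fx.
pose C := 3 * K * L ^+ 3 + 1 + K * L.
have C0 : 0 < C.
  rewrite ltr_wpDr ?mulr_ge0 //.
  by rewrite ltr_wpDl // !mulr_ge0 // exprn_ge0.
pose N := (Num.truncn (L + C / (normc (F x 0) - 1))).+1.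
have hN : L + C / (normc (F x 0) - 1) < N%:R by exact: truncnS_gt.
have d0 : 0 < normc (F x 0) - 1 by rewrite subr_gt0.
have q0 : 0 < C / (normc (F x 0) - 1) by rewrite divr_gt0.
have N0' : 0 < N%:R :> R by rewrite ltr0n.
have LN : L <= N%:R by lra.
have CN : C / N%:R < normc (F x 0) - 1.
  rewrite ltr_pdivrMr // -ltr_pdivrMl // mulrC.
  by apply: lt_trans hN; rewrite ltrDr (lt_le_trans _ L1).
pose i := Num.truncn (x * N%:R).
have xN0 : 0 <= x * N%:R by rewrite mulr_ge0 // ?(ltW N0'); case/andP: hx.
have /andP[i1 i2] := truncn_itv xN0.
have iN : (i <= N)%N.
  rewrite -(ler_nat R); apply: le_trans i1 _; rewrite ler_piMl // ?(ltW N0').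
  by case/andP: hx.
have hi : (0 <= i%:R / N%:R :> R) && (i%:R / N%:R <= 1 :> R).
  apply/andP; split; first exact: divr_ge0.
  by rewrite ler_pdivrMr // mul1r ler_nat.
have hxi : `|x - i%:R / N%:R| <= N%:R^-1.
  rewrite ger0_norm; last by rewrite subr_ge0 ler_pdivrMr.
  rewrite lerBlDr -[X in X + _]mul1r -mulrDl ler_pdivlMr // addrC natr1 ltW //.
have h1 := @F_lip x _ 0 hx hi; have h2 := @M_ub _ 0 hi.
have h3 := @M_grid N i (ltn0Sn _) LN iN F0 F1.
have h4 : K * L * `|x - i%:R / N%:R| <= K * L / N%:R.
  by rewrite ler_wpM2l // mulr_ge0.
have h5 : C / N%:R = (3 * K * L ^+ 3 + 1) / N%:R + K * L / N%:R by rewrite -mulrDl.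
lra.
Qed.

End ThreeLines.

(** Multiplication by the exponential [M0^(s-1) M1^(-s)], which only shifts the
    frequencies, reduces to bounds equal to [1] on both lines. *)
Lemma three_lines (R : realType) (T : finType) (a : T -> R[i]) (l : T -> R)
    (M0 M1 x : R) : 0 < M0 -> 0 < M1 -> 0 <= x <= 1 ->
  (forall y, normc (expsum a l 0 y) <= M0) ->
  (forall y, normc (expsum a l 1 y) <= M1) ->
  normc (expsum a l x 0) <= M0 `^ (1 - x) * M1 `^ x.
Proof.
move=> M00 M10 hx h0 h1.
pose b t := a t * real_complex R M0^-1.
pose m t := l t + (ln M0 - ln M1).
have e u y : normc (expsum b m u y) =
    normc (expsum a l u y) * (M0^-1 * expR ((ln M0 - ln M1) * u)).
  have -> : expsum b m u y = expsum a l u y *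
     (real_complex R (M0^-1 * expR ((ln M0 - ln M1) * u)) *
      cis ((ln M0 - ln M1) * y)).
    rewrite /expsum mulr_suml; apply: eq_bigr => t _.
    by rewrite /b /m !mulrDl expRD cisD -!mulrDl !rmorphM /=; ring.
  rewrite !Normc.normcM normc_cis mulr1 normcR ger0_norm //.
  by rewrite mulr_ge0 ?expR_ge0 ?invr_ge0 ?ltW.
have p0 : 0 < M0^-1 * expR ((ln M0 - ln M1) * x).
  by rewrite mulr_gt0 ?invr_gt0 ?expR_gt0.
have -> : M0 `^ (1 - x) * M1 `^ x = (M0^-1 * expR ((ln M0 - ln M1) * x))^-1.
  rewrite /powR !gt_eqF // -expRD invfM invrK -expRN -{2}(@lnK _ M0) ?posrE //.
  by rewrite -expRD; congr expR; ring.
rewrite -[leRHS]mul1r ler_pdivlMr // -e.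
apply: three_lines_unit => // y; rewrite e.
  by rewrite mulr0 expR0 mulr1 ler_pdivrMr // mul1r.
rewrite mulr1 expRB !lnK ?posrE // mulKf ?gt_eqF //.
by rewrite ler_pdivrMr // mul1r.
Qed.

(** * Interpolation between balls *)

(** Along the curve described at the beginning, every monomial becomes
    one exponential, with frequency [(a1 - a0) \sum_(i in J) ln |z_i|]. *)
Lemma poly_interpolation (R : realType) (n : nat) (S : {set {set 'I_n}})
    (c : {set 'I_n} -> R[i]) (a0 a1 x M0 M1 : R) (z : 'rV[R[i]]_n) :
  0 < M0 -> 0 < M1 -> 0 <= x <= 1 -> (1 - x) * a0 + x * a1 = 1 ->
  (forall w : 'rV[R[i]]_n,
     (forall i, normc (w ord0 i) <= normc (z ord0 i) `^ a0) ->
     normc (signed_poly S c w) <= M0) ->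
  (forall w : 'rV[R[i]]_n,
     (forall i, normc (w ord0 i) <= normc (z ord0 i) `^ a1) ->
     normc (signed_poly S c w) <= M1) ->
  normc (signed_poly S c z) <= M0 `^ (1 - x) * M1 `^ x.
Proof.
move=> M00 M10 hx hax h0 h1.
pose r i := normc (z ord0 i).
(* The phase of [z_i]; it vanishes with [z_i] because [0^-1 = 0]. *)
pose om i := z ord0 i * real_complex R (r i)^-1.
pose e (t u v : R) i := om i * real_complex R (expR ((a0 + t) * ln (r i))) *
   (real_complex R (expR ((a1 - a0) * u * ln (r i))) * cis ((a1 - a0) * v * ln (r i))).
pose w u v : 'rV[R[i]]_n := \row_i e 0 u v i.
pose a (J : {set 'I_n}) := if J \in S then
  c J * \prod_(i in J) (om i * real_complex R (expR (a0 * ln (r i)))) else 0.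
pose l (J : {set 'I_n}) := (a1 - a0) * \sum_(i in J) ln (r i).
have pe u v : signed_poly S c (w u v) = expsum a l u v.
  rewrite /signed_poly /expsum big_mkcond /=; apply: eq_bigr => J _.
  rewrite /a; case: ifP => _; last by rewrite !mul0r.
  rewrite /set_monomial -!mulrA; congr (_ * _).
  under eq_bigr do rewrite /w mxE /e addr0.
  have hl t : (a1 - a0) * ((\sum_(i in J) ln (r i)) * t) =
      \sum_(i in J) (a1 - a0) * t * ln (r i) by rewrite -mulr_sumr; ring.
  rewrite big_split /= [X in _ * X]big_split /=; congr (_ * (_ * _)).
    by rewrite hl expR_sum rmorph_prod.
  by rewrite hl cis_sum.
have r0 i : 0 <= r i := normc_ge0 _.
have nom i : r i != 0 -> normc (om i) = 1.
  move=> ri; rewrite /om Normc.normcM normcR ger0_norm ?invr_ge0 //.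
  by rewrite mulfV.
have om0 i : r i = 0 -> om i = 0.
  by move=> ri; rewrite /om (Normc.eq0_normc ri) mul0r.
have nw u v i : normc (w u v ord0 i) <= r i `^ (a0 + (a1 - a0) * u).
  rewrite /w mxE /e addr0.
  have [ri|ri] := eqVneq (r i) 0; first by rewrite om0 // !mul0r Normc.normc0 powR_ge0.
  rewrite Normc.normcM (Normc.normcM (om i)) nom // Normc.normcM !normcR normc_cis.
  rewrite mulr1 mul1r.
  by rewrite !ger0_norm ?expR_ge0 // -expRD /powR (negbTE ri) -mulrDl.
have zw : w x 0 = z.
  apply/rowP => i; rewrite mxE /e mulr0 mul0r cis0 mulr1 addr0.
  have [ri|ri] := eqVneq (r i) 0.
    by rewrite om0 // !mul0r (Normc.eq0_normc ri).
  rewrite -mulrA -rmorphM /= -expRD -mulrDl.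
  have -> : a0 + (a1 - a0) * x = 1 by rewrite -hax; ring.
  have rp : 0 < r i by rewrite lt_neqAle eq_sym ri r0.
  rewrite mul1r lnK ?posrE //.
  by rewrite /om -mulrA -rmorphM /= mulVf // rmorph1 mulr1.
rewrite -zw pe; apply: three_lines => // y; rewrite -pe.
  by apply: h0 => i; apply: le_trans (nw _ _ _) _; rewrite mulr0 addr0.
by apply: h1 => i; apply: le_trans (nw _ _ _) _; rewrite mulr1 addrC subrK.
Qed.

(** The exponent [q >= 2] lies between [2] and infinity, with
    [a0 = q / 2], [a1 = 0], [x = 1 - 2 / q]; the exponent [q <= 2] lies between
    [1] and [2], with [a0 = q], [a1 = q / 2], [x = 2 - 2 / q]. *)
Lemma interpolated_bounds (R : realType) (n k : nat) (S : {set {set 'I_n}})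
    (c : {ffun {set 'I_n} -> bool}) (A B : R) :
  (2 <= n)%N -> 1 <= A -> 1 <= B -> (forall J, J \in S -> #|J| = k.+1) ->
  (forall z : 'I_n -> R[i], (forall i, normc (z i) <= 1) ->
     normc (block_sum S c z) <= B * Num.sqrt (n%:R ^+ k.+1)) ->
  (forall z : 'I_n -> R[i], \sum_i normc (z i) ^+ 2 <= 1 ->
     normc (block_sum S c z) <= A * (ln n%:R * Num.sqrt (ln n%:R))) ->
  (forall (q : R) (z : 'rV[R[i]]_n), 2 <= q ->
     \sum_i normc (z ord0 i) `^ q <= 1 ->
     normc (signed_poly S (fun J => (-1) ^+ c J) z) <=
     A * B * (ln n%:R `^ (3 / q) * n%:R `^ (k.+1%:R / 2 * ((q - 2) / q)))) /\
  (forall (q : R) (z : 'rV[R[i]]_n), 1 <= q -> q <= 2 ->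
     \sum_i normc (z ord0 i) `^ q <= 1 ->
     normc (signed_poly S (fun J => (-1) ^+ c J) z) <=
     A * B * ln n%:R `^ ((3 * q - 3) / q)).
Proof.
move=> n2 A1 B1 hS cinf c2; pose b : R := ln n%:R.
have b2 : 2^-1 <= b by exact: ln_nat_ge.
have b0 : 0 < b by lra.
have n0 : 0 < n%:R :> R by rewrite ltr0n; lia.
have bb : b * Num.sqrt b = b `^ (3 / 2).
  rewrite -powR12_sqrt ?ltW // -{1}(@powRr1 _ b) ?ltW // -powRD.
    by congr (_ `^ _); field.
  by apply/implyP => _; rewrite gt_eqF.
have nn : Num.sqrt (n%:R ^+ k.+1) = n%:R `^ (k.+1%:R / 2) :> R.
  by rewrite -powR12_sqrt ?exprn_ge0 ?ltW // -powR_mulrn ?ltW // -powRrM.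
have sq (r q : R) : 0 <= r -> (r `^ (q / 2)) ^+ 2 = r `^ q.
  by move=> r0; rewrite -powR_mulrn ?powR_ge0 // -powRrM divfK.
have h2 (q : R) (z w : 'rV[R[i]]_n) : \sum_i normc (z ord0 i) `^ q <= 1 ->
    (forall i, normc (w ord0 i) <= normc (z ord0 i) `^ (q / 2)) ->
    normc (signed_poly S (fun J => (-1) ^+ c J) w) <= A * b `^ (3 / 2).
  move=> hz hw; rewrite -bb; apply: (c2 (fun i => w ord0 i)).
  apply: le_trans hz; apply: ler_sum => i _; rewrite -sq ?normc_ge0 //.
  by rewrite lerXn2r ?nnegrE ?normc_ge0 ?powR_ge0.
have A0 : 0 < A by exact: lt_le_trans A1.
have B0 : 0 < B by exact: lt_le_trans B1.
have M2 : 0 < A * b `^ (3 / 2) by exact: mulr_gt0 A0 (powR_gt0 _ b0).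
have Minf : 0 < B * n%:R `^ (k.+1%:R / 2) :> R by exact: mulr_gt0 B0 (powR_gt0 _ n0).
have pw (C u v x : R) : 1 <= C -> 0 < u -> 0 <= x <= 1 ->
    (C * u `^ v) `^ x <= C * u `^ (v * x).
  move=> C1 u0 /andP[x0 x1]; rewrite powRM ?powR_ge0 //; last exact: le_trans C1.
  by rewrite -powRrM ler_wpM2r ?powR_ge0 // ler1_powR.
split=> [q z q2 hz|q z q1 q2 hz].
  have q0 : 0 < q by exact: lt_le_trans q2.
  have qn : q != 0 by rewrite gt_eqF.
  have iq : 0 <= 2 / q <= 1.
    by rewrite divr_ge0 ?(ltW q0) //= ler_pdivrMr // mul1r.
  have iq' : 0 <= 1 - 2 / q <= 1.
    by case/andP: iq => i0 i1; rewrite subr_ge0 i1 gerBl i0.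
  have := @poly_interpolation R n S (fun J => (-1) ^+ c J) (q / 2) 0 (1 - 2 / q)
    _ _ z M2 Minf.
  have -> : 1 - (1 - 2 / q) = 2 / q by ring.
  move=> H; apply: le_trans (H _ _ _ _) _.
  - exact: iq'.
  - by field.
  - by move=> w; exact: h2.
  - move=> w hw; rewrite -nn; apply: (cinf (fun i => w ord0 i)) => i.
    by apply: le_trans (hw i) _; rewrite powRr0.
  apply: le_trans (ler_pM (powR_ge0 _ _) (powR_ge0 _ _) (pw _ _ _ _ _ b0 iq)
    (pw _ _ _ _ _ n0 iq')) _ => //.
  have -> : 3 / 2 * (2 / q) = 3 / q by field.
  have -> : k.+1%:R / 2 * (1 - 2 / q) = k.+1%:R / 2 * ((q - 2) / q) by field.
  by rewrite -/b le_eqVlt; apply/orP; left; apply/eqP; ring.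
have q0 : 0 < q by exact: lt_le_trans q1.
have qn : q != 0 by rewrite gt_eqF.
have ix : 0 <= 2 - 2 / q <= 1.
  have k1 : 2 / q <= 2 by rewrite ler_pdivrMr //; lra.
  have k2 : 1 <= 2 / q by rewrite ler_pdivlMr //; lra.
  by apply/andP; split; lra.
have := @poly_interpolation R n S (fun J => (-1) ^+ c J) q (q / 2) (2 - 2 / q)
  1 _ z ltr01 M2 ix.
move=> H; apply: le_trans (H _ _ _) _.
- by field.
- move=> w hw; apply: (@block_sum_l1 R n k S c (fun i => w ord0 i) hS).
  by apply: le_trans hz; apply: ler_sum.
- by move=> w; exact: h2.
rewrite powR1 mul1r; apply: le_trans (pw _ _ _ _ _ b0 ix) _ => //.
have -> : 3 / 2 * (2 - 2 / q) = (3 * q - 3) / q by field.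
by rewrite -/b ler_wpM2r ?powR_ge0 // ler_peMr // ltW.
Qed.

Lemma sup_norm_le (R : realType) (n : nat) (q M : R) (p : 'rV[R[i]]_n -> R[i]) :
  0 < q ->
  (forall z : 'rV[R[i]]_n, \sum_i normc (z ord0 i) `^ q <= 1 -> normc (p z) <= M) ->
  (sup_norm q p <= M%:E)%E.
Proof.
move=> q0 h; apply: ge_ereal_sup => _ [z hz <-]; rewrite lee_fin; apply: h.
have s0 : 0 <= \sum_i normc (z ord0 i) `^ q by apply: sumr_ge0 => i _; exact: powR_ge0.
move: hz; rewrite /lq_norm /=; move: (\sum_i _) s0 => s s0 hs.
have -> : s = (s `^ q^-1) `^ q by rewrite -powRrM mulVf ?powRr1 // lt0r_neq0.
apply: le_trans (ge0_ler_powR (ltW q0) _ _ hs) _; rewrite ?nnegrE ?powR_ge0 //.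
by rewrite powR1.
Qed.

Theorem theorem2p5 (R : realType) :
  exists A : nat -> R -> R,
    (forall (k : nat) (q : R), (2 <= k)%N -> 1 <= q -> 0 < A k q) /\
    (forall (k k' : nat) (q : R), (2 <= k)%N -> (2 <= k')%N -> 1 <= q ->
       q <> 2 -> A k q = A k' q) /\
    (forall (k n : nat) (S : {set {set 'I_n}}), (2 <= k)%N ->
       partial_steiner k.-1 k S ->
       exists c : {set 'I_n} -> R[i],
         (forall J : {set 'I_n}, J \in S -> c J = 1 \/ c J = -1) /\
         (forall q : R, 2 <= q ->
            (sup_norm q (signed_poly S c) <=
             (A k q * (ln n%:R `^ (3 / q) *
                       n%:R `^ (k%:R / 2 * ((q - 2) / q))))%:E)%E) /\
         (forall q : R, 1 <= q -> q <= 2 ->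
            (sup_norm q (signed_poly S c) <=
             (A k q * ln n%:R `^ ((3 * q - 3) / q))%:E)%E)).
Proof.
have C0 : 0 < 1600 * 200 :> R by rewrite mulr_gt0 ?ltr0n.
exists (fun _ _ => 1600 * 200); split; [by move=> *; exact: C0 | split; [by [] |]].
move=> [//|k] n S k2 hS; rewrite ltnS in k2.
have [n1|n2] := leqP n 1.
  have S0 z c : signed_poly S c z = 0.
    rewrite /signed_poly big1 // => J JS.
    have := max_card (mem J); rewrite hS.1 // card_ord; lia.
  exists (fun=> 1); split; first by move=> J _; left.
  have q0 (q : R) : 1 <= q -> 0 < q by exact: lt_le_trans.
  split=> q q1 => [|q2]; apply: sup_norm_le => [|z _].
  - by rewrite (lt_le_trans _ q1).
  - by rewrite S0 Normc.normc0 mulr_ge0 ?(ltW C0) // mulr_ge0 ?powR_ge0.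
  - exact: q0.
  - by rewrite S0 Normc.normc0 mulr_ge0 ?(ltW C0) // powR_ge0.
have [c [cinf c2]] := @exists_signs_l2_linf R n k S n2 k2 hS.
have A1 : 1 <= 1600 :> R by rewrite ler1n.
have B1 : 1 <= 200 :> R by rewrite ler1n.
have [{}c1 {}c2] := interpolated_bounds n2 A1 B1 hS.1 cinf c2.
exists (fun J => (-1) ^+ c J); split.
  by move=> J _; case: (c J); [right; rewrite expr1 | left; rewrite expr0].
split=> q q1 => [|q2]; apply: sup_norm_le => [|z hz].
- by rewrite (lt_le_trans _ q1).
- exact: c1.
- by rewrite (lt_le_trans _ q1).
- exact: c2.
Qed.
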